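(* Let $H$ be a complex Hilbert space, let $T\in B(H)$ be power bounded with $\sigma_p(T)\cap\mathbb{T}=\emptyset$, let $A\subset\mathbb{N}$ be regular, let $f\in P_m$ for some $m\in\mathbb{N}$, and let $(h_n)$ be a bounded integer-valued sequence. Then for every $x\in H$ $$ \lim_{N\to\infty}\frac{1}{\operatorname{card}(A\cap[1,N])}\sum_{n\in A\cap[1,N]}T^{[f(n)]+h_n}x=0 $$ in the norm of $H$; that is, these averages converge to $0$ in the strong operator topology.
   Context: $\mathbb{T}$ is the unit circle in $\mathbb{C}$, $\sigma_p(T)$ is the set of eigenvalues of $T$, $T$ is power bounded if $\sup_{n\ge0}\|T^n\|<\infty$, $[\cdot]$ applied to a real number is the integer part, and for integers $a\le b$, $[a,b]$ denotes the set of integers $n$ with $a\le n\le b$. Convention: $T^{[f(n)]+h_n}=I$ if the exponent is negative or $f(n)$ is not defined (this concerns only finitely many $n$). A set $A\subset\mathbb{N}$ has density $\operatorname{dens}A$ if $\lim_{n\to\infty}\operatorname{card}(A\cap[1,n])/n=\operatorname{dens}A$ exists. A set $A\subset\mathbb{N}$ is regular if it has density $\operatorname{dens}A>0$ and, for all $K\in\mathbb{N}$ and each $B\subset[0,K]$, the set $\{n\in\mathbb{N}: n+j\in A\Leftrightarrow j\in B\ (j=0,\dots,K)\}$ has density (positive or zero). Class $P_m$ ($m\in\mathbb{N}$, $m\ge1$): a continuous real function $f$ defined on some interval $[t_0,\infty)$ (functions agreeing for all large $t$ are identified) is of class $P_m$ if, for all $t$ large enough, $f$ has continuous derivatives $f',\dots,f^{(m)}$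 with $f,f',\dots,f^{(m)}>0$, and $$\limsup_{t\to\infty}\frac{f^{(m-1)}(t)}{t f^{(m)}(t)}<\infty,\qquad \limsup_{t\to\infty}\sup\Bigl\{\frac{f^{(m)}(s)}{f^{(m)}(t)}: s\ge t\Bigr\}<\infty.$$ *)

(* Defs.v *)
(* MathComp-Analysis *)
From mathcomp Require Import all_boot all_order all_algebra.
From mathcomp Require Import complex.
From mathcomp Require Import all_classical all_reals all_analysis.

Set Implicit Arguments.
Unset Strict Implicit.
Unset Printing Implicit Defensive.

Import Order.TTheory GRing.Theory Num.Theory.
Import numFieldNormedType.Exports.

Local Open Scope classical_set_scope.
Local Open Scope ring_scope.
Local Open Scope complex_scope.

(* Together with the completeness of H, this makes (H, dot) a Hilbert space;
   dot is linear in its first argument and conjugate-linear in the second. *)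
Definition norm_from_dot (R : realType) (H : normedModType R[i])
    (dot : {dot H for @Num.conj R[i]}) : Prop :=
  forall x : H, `|x| ^+ 2 = dot x x.

Section Operators.
Variables (R : realType) (H : normedModType R[i]).
Implicit Type T : H -> H.

(* The norm of H takes (nonnegative real) values in R[i], hence the Re. *)
Definition op_norm T : \bar R :=
  ereal_sup [set (complex.Re `|T x|)%:E | x in [set x : H | `|x| <= 1]].

Definition power_bounded T : Prop :=
  (ereal_sup (range (fun n : nat => op_norm (iter n T))) < +oo)%E.

Definition point_spectrum T : set R[i] :=
  [set l | exists2 x : H, x != 0 & T x = l *: x].

Definition unit_circle : set R[i] := [set z | `|z| = 1].

(* T^([f n] + h n), read as the identity if the exponent is negative or if n
   lies outside the domain [t0, +oo[ of f. *)
Definition op_pow T (t0 : R) (f : R -> R) (h : nat -> int) (n : nat) : H -> H :=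
  let e : int := Num.floor (f n%:R) + h n in
  if (t0 <= n%:R) && (0 <= e) then iter `|e|%N T else idfun.

End Operators.

Definition card_upto (A : set nat) (n : nat) : nat :=
  count (fun k => k \in A) (index_iota 1 n.+1).

Section Density.
Variable R : realType.

Definition has_density (A : set nat) (d : R) : Prop :=
  (fun n : nat => (card_upto A n)%:R / n%:R : R) @ \oo --> d.

Definition regular (A : set nat) : Prop :=
  (exists2 d : R, 0 < d & has_density A d) /\
  (forall (K : nat) (B : set nat), B `<=` [set j | (j <= K)%N] ->
    exists d : R, has_density
      [set n | forall j, (j <= K)%N -> (A (n + j)%N <-> B j)] d).

End Density.

Section ClassP.
Variable R : realType.
Local Open Scope ereal_scope.

(* A function defined on [t0, +oo[ is given by a total f : R -> R whose values
   on ]-oo, t0[ are irrelevant. *)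
Definition class_P (m : nat) (t0 : R) (f : R -> R) : Prop :=
  [/\ {within `[t0, +oo[, continuous f},
      \forall t \near +oo%R,
        (forall k, (k < m)%N -> derivable (derive1n k f) t 1%R) /\
        (forall k, (k <= m)%N ->
          {for t, continuous (derive1n k f)} /\ (0 < derive1n k f t)%R),
      limf_esup (fun t : R => (derive1n m.-1 f t / (t * derive1n m f t))%R%:E)
        +oo%R < +oo &
      limf_esup (fun t : R =>
          ereal_sup [set (derive1n m f s / derive1n m f t)%R%:E
                    | s in [set s : R | (t <= s)%R]])
        +oo%R < +oo].

End ClassP.

(* Main.v *)
(** Call a sequence [a] of exponents null if the averages of [c n * T ^ (a n) x]
    tend to [0] uniformly over all coefficients with [|c n| <= 1].  It suffices
    to show that [a] is null as soon as [a n - f n] is bounded, [f] in P_m: the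
    perturbation [h] is then absorbed by [a], and the set [A] by the coefficients.

    The window form [b_M (u, v) = sum_(m < M) <T ^ m u, T ^ m v>] is invariant
    under [T] up to [O(1)], so [T] is almost isometric for [b_M / M].  Since [T]
    is power bounded, [T ^ s] with [s <= M] can be factored out of a sum of
    powers [T ^ (M + e)], and averaging over [s] turns the norm into the window
    form.  This yields a van der Corput inequality: [a] is null if it varies
    slowly and if, for suitable [J], the correlations
    [b_M (T ^ (a (n + l) - a (n + j)) x, x)], [j, l < J], are small on average.

    - [a n = n]: the rotated averages of [z ^ n T ^ n x] tend to [0] uniformly
      in [|z| = 1] (mean ergodic theorem and compactness of the circle).  By a
      discrete Herglotz formula the correlations [b_M (T ^ n x, x)] are Fourier
      coefficients of a positive measure, so the average of [T ^ n x] against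
      their conjugates is a mean of rotated averages, hence small; applying
      [b_M (_, x)] shows that they are small in quadratic mean.
    - P_1: [a] takes each value [O (n / f n)] times up to [n], so the claim
      reduces to [a n = n].
    - P_m, [m >= 2]: the differences of [f] lie in P_(m-1), so the sequences
      [a (n + l) - a (n + j)] are null by induction. *)
Require Import Defs.
From mathcomp Require Import all_boot all_order all_algebra.
From mathcomp Require Import complex.
From mathcomp Require Import all_classical all_reals all_analysis.
From mathcomp Require Import ring lra zify.

Import Order.TTheory GRing.Theory Num.Theory.
Import numFieldNormedType.Exports.

Set Implicit Arguments.
Unset Strict Implicit.
Unset Printing Implicit Defensive.

Local Open Scope classical_set_scope.
Local Open Scope ring_scope.
Local Open Scope complex_scope.

(** * Real-valued norms and the inner product *)

Section RealNorm.
Variables (R : realType) (V : normedZmodType R[i]).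
Implicit Types x y : V.

(** Norms live in [R[i]], whose order is only partial; the real part moves estimates and suprema to
    [R]. *)
Definition rnorm x : R := complex.Re `|x|.

Lemma rnormE x : `|x| = (rnorm x)%:C.
Proof. by rewrite RRe_real // normr_real. Qed.

Lemma rnorm_ge0 x : 0 <= rnorm x.
Proof. by rewrite -ler0c -rnormE normr_ge0. Qed.

Lemma rnorm0 : rnorm 0 = 0.
Proof. by rewrite /rnorm normr0. Qed.

Lemma rnorm_eq0 x : rnorm x = 0 -> x = 0.
Proof. by move=> x0; apply/eqP; rewrite -normr_eq0 rnormE x0. Qed.

Lemma rnormN x : rnorm (- x) = rnorm x.
Proof. by rewrite /rnorm normrN. Qed.

Lemma rnormD x y : rnorm (x + y) <= rnorm x + rnorm y.
Proof. by rewrite -lecR rmorphD /= -!rnormE ler_normD. Qed.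

Lemma rnormB x y : rnorm (x - y) <= rnorm x + rnorm y.
Proof. by rewrite -(rnormN y) rnormD. Qed.

Lemma rnorm_sum (I : Type) (r : seq I) (P : pred I) (F : I -> V) :
  rnorm (\sum_(i <- r | P i) F i) <= \sum_(i <- r | P i) rnorm (F i).
Proof.
elim/big_rec2: _ => [|i y z _ le_zy]; first by rewrite rnorm0.
by rewrite (le_trans (rnormD _ _))// lerD2l.
Qed.

End RealNorm.

Section RealNormC.
Variable R : realType.
Implicit Types a b : R[i].

Lemma rnormM a b : rnorm (a * b) = rnorm a * rnorm b.
Proof. by apply: complexI; rewrite rmorphM /= -!rnormE normrM. Qed.

Lemma rnormX a n : rnorm (a ^+ n) = rnorm a ^+ n.
Proof. by apply: complexI; rewrite rmorphXn /= -!rnormE normrX. Qed.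

Lemma rnorm_real (r : R) : rnorm r%:C = `|r|.
Proof. by rewrite /rnorm normc_def /= expr0n/= addr0 sqrtr_sqr. Qed.

Lemma rnorm1 : rnorm (1 : R[i]) = 1.
Proof. by rewrite /rnorm normr1. Qed.

Lemma rnorm_conj a : rnorm a^*%R = rnorm a.
Proof. by rewrite /rnorm norm_conjC. Qed.

Lemma Re_le_rnorm a : complex.Re a <= rnorm a.
Proof. by rewrite (le_trans (ler_norm _))// -lecR -rnormE normc_ge_Re. Qed.

Lemma mulC_rnorm a : a^*%R * a = (rnorm a ^+ 2)%:C.
Proof. by rewrite mulrC -normCK rnormE rmorphXn. Qed.

Lemma rnormZ (V : normedModType R[i]) a (x : V) :
  rnorm (a *: x) = rnorm a * rnorm x.
Proof. by apply: complexI; rewrite rmorphM /= -!rnormE normrZ. Qed.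

End RealNormC.

Section Hilbert.
Variables (R : realType) (H : normedModType R[i]).
Variables (dot : {dot H for @Num.conj R[i]}) (dotE : norm_from_dot dot).
Implicit Types u v : H.

Lemma dotxx u : dot u u = (rnorm u ^+ 2)%:C.
Proof. by rewrite -dotE rnormE rmorphXn. Qed.

Lemma dot_suml (I : Type) (r : seq I) (P : pred I) (F : I -> H) v :
  dot (\sum_(i <- r | P i) F i) v = \sum_(i <- r | P i) dot (F i) v.
Proof.
elim/big_rec2: _ => [|i y z _ <-]; first by rewrite linear0l.
by rewrite linearDl.
Qed.

Lemma dot_sumr (I : Type) (r : seq I) (P : pred I) (F : I -> H) v :
  dot v (\sum_(i <- r | P i) F i) = \sum_(i <- r | P i) dot v (F i).
Proof.
elim/big_rec2: _ => [|i y z _ <-]; first by rewrite linear0r.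
by rewrite linearDr.
Qed.

Lemma dotZl a u v : dot (a *: u) v = a * dot u v.
Proof. by rewrite linearZl_LR. Qed.

Lemma dotZr a u v : dot u (a *: v) = a^*%R * dot u v.
Proof. by rewrite linearZr_LR. Qed.

Lemma dotC u v : dot u v = (dot v u)^*%R.
Proof. by rewrite hermC expr0 mul1r. Qed.

Lemma rnormD_sq u v :
  rnorm (u + v) ^+ 2 = rnorm u ^+ 2 + rnorm v ^+ 2 + complex.Re (dot u v) *+ 2.
Proof.
have := dotxx (u + v); rewrite linearDl/= !linearDr/= !dotxx (dotC v u).
move=> /(congr1 (@complex.Re R)) /= <-.
by case: (dot u v) => a b /=; ring.
Qed.

Lemma parallelogram u v :
  rnorm (u + v) ^+ 2 + rnorm (u - v) ^+ 2 = (rnorm u ^+ 2 + rnorm v ^+ 2) *+ 2.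
Proof.
rewrite !rnormD_sq rnormN linearNr /=.
by case: (dot u v) => a b /=; ring.
Qed.

Lemma cauchy_schwarz u v : rnorm (dot u v) <= rnorm u * rnorm v.
Proof.
have [->|v0] := eqVneq v 0; first by rewrite linear0r !rnorm0 mulr0.
have nv : 0 < rnorm v.
  by rewrite lt_neqAle rnorm_ge0 andbT eq_sym; apply: contra_neq v0 => /rnorm_eq0.
rewrite -(@ler_pXn2r _ 2) ?nnegrE ?mulr_ge0 ?rnorm_ge0//.
(* The squared norm of [|v|^2 u - <u, v> v] expands to [|v|^2 (|u|^2 |v|^2 - |<u, v>|^2)]. *)
have := sqr_ge0 (rnorm ((rnorm v ^+ 2)%:C *: u - dot u v *: v)).
rewrite rnormD_sq rnormN !rnormZ rnorm_real linearNr/= dotZl dotZr.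
rewrite (_ : _ * (_ * _) = ((rnorm v ^+ 2) * rnorm (dot u v) ^+ 2)%:C); last first.
  by rewrite mulC_rnorm [in RHS]rmorphM.
rewrite /= ger0_norm ?sqr_ge0// => h.
have {h} : 0 <= rnorm v ^+ 2 * ((rnorm u * rnorm v) ^+ 2 - rnorm (dot u v) ^+ 2).
  by apply: le_trans h _; rewrite le_eqVlt; apply/orP; left; apply/eqP; ring.
by rewrite pmulr_rge0 ?exprn_gt0// subr_ge0.
Qed.

End Hilbert.

(** * The mean ergodic theorem, uniformly on the circle *)

Section Completeness.
Variables (R : realType) (H : completeNormedModType R[i]).

Lemma rnorm_complete (u : nat -> H) :
  (forall eps : R, 0 < eps -> exists K, forall j k, (K <= j)%N -> (K <= k)%N ->
     rnorm (u j - u k) < eps) ->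
  exists l : H, forall eps : R, 0 < eps -> exists K, forall k, (K <= k)%N ->
    rnorm (l - u k) < eps.
Proof.
move=> ucauchy.
(* In the order of [R[i]] every positive element is real, so radii may be taken in [R]. *)
have realE (e : R[i]) : 0 < e -> 0 < complex.Re e /\ e = (complex.Re e)%:C.
  by case: e => a b /=; rewrite ltcE /= => /andP[/eqP -> a0].
have cu : cvg (u @ \oo).
  apply/cauchy_cvgP/cauchy_exP => e /realE[e0 eE].
  have [K hK] := ucauchy _ e0; exists (u K), K => // k /= Kk.
  by rewrite -ball_normE /= rnormE eE ltcR hK.
exists (lim (u @ \oo)) => eps eps0.
have : (0 : R[i]) < eps%:C by rewrite ltcR.
move/cvgrPdist_lt: cu => /[apply] -[K _ hK].
by exists K => k /hK /=; rewrite rnormE ltcR.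
Qed.

End Completeness.

Section IterLinear.
Variables (K : pzRingType) (V : lmodType K) (T : {linear V -> V}).

Lemma iter_linD n u v : iter n T (u + v) = iter n T u + iter n T v.
Proof. by elim: n => //= n ->; rewrite linearD. Qed.

Lemma iter_linZ n a v : iter n T (a *: v) = a *: iter n T v.
Proof. by elim: n => //= n ->; rewrite linearZ. Qed.

Lemma iter_lin0 n : iter n T 0 = 0.
Proof. by elim: n => //= n ->; rewrite linear0. Qed.

Lemma iter_linB n u v : iter n T (u - v) = iter n T u - iter n T v.
Proof. by rewrite iter_linD -scaleN1r iter_linZ scaleN1r. Qed.

Lemma iter_lin_sum n (I : Type) (r : seq I) (P : pred I) (F : I -> V) :
  iter n T (\sum_(i <- r | P i) F i) = \sum_(i <- r | P i) iter n T (F i).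
Proof.
elim/big_rec2: _ => [|i y z _ <-]; first by rewrite iter_lin0.
by rewrite iter_linD.
Qed.

End IterLinear.

Section MeanErgodic.
Variables (R : realType) (H : completeNormedModType R[i]).
Variables (dot : {dot H for @Num.conj R[i]}) (dotE : norm_from_dot dot).
Variables (T : {linear H -> H}) (C : R) (C1 : 1 <= C).
Hypothesis Tpow : forall n u, rnorm (iter n T u) <= C * rnorm u.
Variables (z : R[i]) (z1 : rnorm z = 1).
Hypothesis noeig : forall u, z *: T u = u -> u = 0.

(** By [noeig], [D] is injective. The ergodic theorem follows once its range is shown to be
    dense. *)
Let D u := z *: T u - u.

Let DD u v : D (u + v) = D u + D v.
Proof. by rewrite /D linearD scalerDr opprD addrACA. Qed.

Let DZ a u : D (a *: u) = a *: D u.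
Proof. by rewrite /D linearZ scalerA mulrC -scalerA scalerBr. Qed.

Let DN u : D (- u) = - D u.
Proof. by rewrite -scaleN1r DZ scaleN1r. Qed.

Let DB u v : D (u - v) = D u - D v.
Proof. by rewrite DD DN. Qed.

Let D_sum n (F : 'I_n -> H) : D (\sum_(i < n) F i) = \sum_(i < n) D (F i).
Proof.
elim/big_rec2: _ => [|i y v _ <-]; first by rewrite /D linear0 scaler0 subr0.
by rewrite DD.
Qed.

Let D_le u : rnorm (D u) <= (C + 1) * rnorm u.
Proof.
rewrite (le_trans (rnormB _ _))// mulrDl mul1r lerD2r rnormZ z1 mul1r.
exact: (Tpow 1).
Qed.

Lemma rnorm_rotated n u : rnorm (z ^+ n *: iter n T u) <= C * rnorm u.
Proof. by rewrite rnormZ rnormX z1 expr1n mul1r. Qed.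

Lemma sum_rotated n u :
  \sum_(i < n) z ^+ i *: iter i T (D u) = z ^+ n *: iter n T u - u.
Proof.
elim: n => [|n IH]; first by rewrite big_ord0 expr0 scale1r subrr.
rewrite big_ord_recr /= IH /D iter_linB iter_linZ -iterSr scalerBr scalerA.
by rewrite -exprSr addrC addrA subrK.
Qed.

Let D_sum_rotated n u :
  D (\sum_(i < n) z ^+ i *: iter i T u) = z ^+ n *: iter n T u - u.
Proof.
rewrite D_sum -sum_rotated; apply: eq_bigr => i _.
by rewrite DZ /D iter_linB iter_linZ -iterSr -iterS.
Qed.

Let Q x k w := rnorm (D (x - D w)) <= k.+1%:R^-1.

(** The witness makes [x - D w] the mean of [z ^ i T ^ i x] over [i < N], which [D] maps to
    [(z ^ N T ^ N x - x) / N] by telescoping. Its norm stays below [C |x|], so the infima below are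
    bounded uniformly in [k]. *)
Let Q_ex x k : exists2 w, Q x k w & rnorm (x - D w) <= C * rnorm x.
Proof.
pose N := (Num.trunc (k.+1%:R * ((C + 1) * rnorm x))).+1.
have N0 : (N%:R : R[i]) != 0 by rewrite pnatr_eq0.
have N0R : 0 < N%:R :> R by rewrite ltr0n.
have kN : k.+1%:R * ((C + 1) * rnorm x) <= N%:R by rewrite ltW// Num.Theory.truncnS_gt.
pose s n := \sum_(i < n) z ^+ i *: iter i T x.
have NE : (N%:R : R[i])^-1 = (N%:R^-1)%:C by rewrite fmorphV rmorph_nat.
have gE : x - D (- (N%:R^-1 *: \sum_(n < N) s n)) = N%:R^-1 *: s N.
  rewrite DN DZ D_sum (eq_bigr _ (fun (n : 'I_N) _ => D_sum_rotated n x)).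
  rewrite sumrB big_const_ord iter_addr addr0 -/(s N).
  rewrite opprK scalerBr -[x *+ N]scaler_nat scalerA mulVf// scale1r.
  by rewrite addrC subrK.
exists (- (N%:R^-1 *: \sum_(n < N) s n)).
  rewrite /Q gE DZ D_sum_rotated rnormZ NE rnorm_real ger0_norm ?invr_ge0//.
  rewrite ler_pdivrMl// mulrC ler_pdivlMl//.
  apply: le_trans kN; rewrite ler_pM2l ?ltr0n// (le_trans (rnormB _ _))//.
  by rewrite mulrDl mul1r lerD2r rnorm_rotated.
rewrite gE rnormZ NE rnorm_real ger0_norm ?invr_ge0// ler_pdivrMl//.
rewrite (le_trans (rnorm_sum _ _ _))//.
rewrite (le_trans (ler_sum _ (fun (i : 'I_N) _ => rnorm_rotated i x)))//.
by rewrite sumr_const card_ord mulr_natl.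
Qed.

(* Elements of minimal norm among [x - D w] with [D (x - D w)] small form a
   Cauchy sequence, whose limit is killed by [D], hence is [0]. *)
Lemma ran_dense x (eps : R) : 0 < eps -> exists w, rnorm (x - D w) < eps.
Proof.
pose E k := [set rnorm (x - D w) ^+ 2 | w in [set w | Q x k w]].
pose d k := inf (E k).
have lbE k : lbound (E k) 0 by move=> _ [w _ <-]; rewrite sqr_ge0.
have hE k : has_inf (E k).
  by split; [have [w wQ _] := Q_ex x k; exists (rnorm (x - D w) ^+ 2), w|exists 0].
have dlb k w : Q x k w -> d k <= rnorm (x - D w) ^+ 2.
  by move=> wQ; apply: ge_inf; [exists 0|exists w].
have dub k : d k <= (C * rnorm x) ^+ 2.
  have [w wQ wle] := Q_ex x k; rewrite (le_trans (dlb _ _ wQ))//.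
  by rewrite lerXn2r ?nnegrE ?(le_trans _ wle) ?rnorm_ge0.
have Qmono j k w : (j <= k)%N -> Q x k w -> Q x j w.
  by move=> jk /le_trans; apply; rewrite lef_pV2 ?posrE ?ltr0n// ler_nat ltnS.
have dmono j k : (j <= k)%N -> d j <= d k.
  move=> jk; apply: lb_le_inf => [|_ [w wQ <-]]; first exact: (hE k).1.
  exact: dlb (Qmono _ _ _ jk wQ).
have hd : has_sup (range d).
  by split; [exists (d 0), 0|exists ((C * rnorm x) ^+ 2) => _ [k _ <-]].
pose L := sup (range d).
have dL k : d k <= L by apply: ub_le_sup; [exact: hd.2|exists k].
have /choice[w wP] k : exists w, Q x k w /\ rnorm (x - D w) ^+ 2 < d k + k.+1%:R^-1.
  have k0 : 0 < (k.+1%:R : R)^-1 by rewrite invr_gt0 ltr0n.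
  by have [_ [w wQ <-] wlt] := inf_adherent k0 (hE k); exists w.
pose u k := x - D (w k).
have ucauchy eps' : 0 < eps' -> exists K, forall j k, (K <= j)%N -> (K <= k)%N ->
    rnorm (u j - u k) < eps'.
  (* The constraint [Q x K] is convex, so the midpoint of [u j] and [u k] has squared norm at least
     [d K > L - eta]. The parallelogram law then gives [|u j - u k|^2 <= 8 eta < eps'^2]. *)
  move=> eps'0; pose eta := eps' ^+ 2 / 9.
  have eta0 : 0 < eta by rewrite divr_gt0// exprn_gt0.
  have [_ [K1 _ <-] K1L] := sup_adherent eta0 hd.
  pose K := maxn K1 (Num.trunc eta^-1).
  have Keta k : (K <= k)%N -> k.+1%:R^-1 <= eta.
    move=> Kk; rewrite -[leRHS]invrK lef_pV2 ?posrE ?invr_gt0 ?ltr0n//.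
    apply: ltW; apply: lt_le_trans (truncnS_gt _) _.
    by rewrite ler_nat ltnS (leq_trans _ Kk)// leq_maxr.
  have dK : L - eta < d K by apply: lt_le_trans K1L _; rewrite dmono ?leq_maxl.
  have ule k : (K <= k)%N -> rnorm (u k) ^+ 2 <= L + eta.
    by move=> Kk; rewrite (le_trans (ltW (wP k).2))// lerD ?Keta.
  exists K => j k Kj Kk.
  pose h := (2^-1 : R)%:C.
  have hh : h + h = 1 by rewrite -rmorphD/= -[RHS](rmorph1 (real_complex R)); congr _%:C; lra.
  have midE : x - D (h *: (w j + w k)) = h *: (u j + u k).
    have -> : u j + u k = (x + x) - (D (w j) + D (w k)) by rewrite opprD addrACA.
    by rewrite DZ DD scalerBr (scalerDr h x x) -scalerDl hh scale1r.
  have midQ : Q x K (h *: (w j + w k)).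
    rewrite /Q midE DZ DD rnormZ rnorm_real ger0_norm ?invr_ge0//.
    have := Qmono _ _ _ Kj (wP j).1; have := Qmono _ _ _ Kk (wP k).1.
    rewrite /Q -/(u k) -/(u j); move: (K.+1%:R^-1) => e' hk hj.
    have := rnormD (D (u j)) (D (u k)); lra.
  have := dlb _ _ midQ; rewrite midE rnormZ rnorm_real ger0_norm ?invr_ge0//.
  have := parallelogram dotE (u j) (u k).
  have := ule _ Kj; have := ule _ Kk.
  rewrite exprMn mulr2n => h1 h2 h3 h4.
  rewrite -(@ltr_pXn2r _ 2) ?nnegrE ?rnorm_ge0 ?(ltW eps'0)//.
  have : eps' ^+ 2 = 9 * eta by rewrite /eta; field.
  move: h1 h2 h3 h4 eta0 dK; nra.
have [l ul] := rnorm_complete ucauchy.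
have l0 : l = 0.
  apply: noeig; apply/eqP; rewrite -subr_eq0; apply/eqP/rnorm_eq0.
  apply/eqP; rewrite eq_le rnorm_ge0 andbT; apply/ler_addgt0Pl => e e0.
  have e'0 : 0 < e / (2 * (C + 1)) by rewrite divr_gt0// mulr_gt0//; move: C1; lra.
  have [K hK] := ul _ e'0.
  pose k := maxn K (Num.trunc (e / 2)^-1).
  have -> : z *: T l - l = D (l - u k) + D (u k) by rewrite DB subrK.
  rewrite addr0 (le_trans (rnormD _ _))// [leRHS]splitr lerD//.
    rewrite (le_trans (D_le _))// -ler_pdivlMl; last by move: C1; lra.
    rewrite (le_trans (ltW (hK _ (leq_maxl _ _))))// le_eqVlt; apply/orP; left.
    by apply/eqP; field; move: C1; lra.
  rewrite (le_trans (wP k).1)// -[leRHS]invrK lef_pV2 ?posrE ?invr_gt0 ?ltr0n ?divr_gt0//.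
  apply: ltW; apply: lt_le_trans (truncnS_gt _) _.
  by rewrite ler_nat ltnS leq_maxr.
move=> eps0; have [K hK] := ul _ eps0; exists (w K).
by have := hK _ (leqnn K); rewrite l0 sub0r rnormN.
Qed.

(** By [ran_dense], [x] is a small vector plus some [D w]. The rotated average of the former stays
    small by power boundedness; that of the latter telescopes to [O (1 / N)]. *)
Lemma mean_ergodic x (eps : R) : 0 < eps ->
  exists2 N, (0 < N)%N & rnorm (\sum_(n < N) z ^+ n *: iter n T x) <= eps * N%:R.
Proof.
move=> eps0; have C0 : 0 < C by rewrite (lt_le_trans ltr01).
have e0 : 0 < eps / (2 * C) by rewrite divr_gt0// mulr_gt0.
have [w wlt] := ran_dense x e0.
pose N := (Num.trunc ((2 * ((C + 1) * rnorm w)) / eps)).+1.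
exists N => //.
have xE : x = (x - D w) + D w by rewrite subrK.
rewrite {1}xE.
under eq_bigr do rewrite iter_linD scalerDr.
rewrite big_split /= sum_rotated (le_trans (rnormD _ _))//.
rewrite (_ : eps * N%:R = N%:R * (C * (eps / (2 * C))) + (eps / 2) * N%:R); last first.
  by field; rewrite gt_eqF.
apply: lerD.
  rewrite (le_trans (rnorm_sum _ _ _))//.
  rewrite (le_trans (ler_sum _ (fun (i : 'I_N) _ => rnorm_rotated i _)))//.
  rewrite sumr_const card_ord mulr_natl lerMn2r; apply/orP; right.
  by rewrite ler_pM2l// ltW.
rewrite (le_trans (rnormB _ _))// (le_trans (lerD (rnorm_rotated _ _) (lexx _)))//.
have : 2 * ((C + 1) * rnorm w) / eps <= N%:R by rewrite ltW// truncnS_gt.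
rewrite ler_pdivrMr//; lra.
Qed.

End MeanErgodic.

(** * Points of the unit circle and roots of unity *)

Section CirclePoints.
Variable R : realType.
Implicit Types t : R.

Definition cis t : R[i] := (cos t +i* sin t)%C.

Lemma rnorm_cis t : rnorm (cis t) = 1.
Proof. by rewrite /rnorm normc_def /= cos2Dsin2 sqrtr1. Qed.

Lemma cisD s t : cis (s + t) = cis s * cis t.
Proof.
rewrite /cis cosD sinD; apply/eqP; rewrite eq_complex /= eqxx/=.
by apply/eqP; rewrite addrC.
Qed.

Lemma cis0 : cis 0 = 1.
Proof. by rewrite /cis cos0 sin0. Qed.

Lemma cisX t n : cis t ^+ n = cis (n%:R * t).
Proof.
elim: n => [|n IH]; first by rewrite expr0 mul0r cis0.
by rewrite exprS IH -cisD -natr1 mulrDl mul1r addrC.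
Qed.

Lemma cis2pi : cis (pi *+ 2) = 1.
Proof. by rewrite /cis -[pi *+ 2]add0r sinD2pi cosD2pi sin0 cos0. Qed.

Lemma cis_neq1 t : 0 < t < pi *+ 2 -> cis t != 1.
Proof.
case/andP=> t0 t2; apply/negP => /eqP /(congr1 (@complex.Re R)) /= ct.
have s0 : 0 < sin (t / 2).
  by apply: sin_gt0_pi; rewrite divr_gt0//= ltr_pdivrMr// mulr_natr.
have := cos_mulr2n (t / 2); rewrite -[t / 2 *+ 2]mulr_natr divfK// ct.
have := cos2Dsin2 (t / 2); have := exprn_gt0 2 s0; lra.
Qed.

Lemma rnorm_cisB s t : rnorm (cis s - cis t) <= `|cos s - cos t| + `|sin s - sin t|.
Proof.
have -> : cis s - cis t = (cos s - cos t)%:C + 'i%C * (sin s - sin t)%:C.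
  by rewrite [LHS]complexE.
rewrite (le_trans (rnormD _ _))// rnormM !rnorm_real lerD2l.
suff -> : rnorm ('i%C : R[i]) = 1 by rewrite mul1r.
by rewrite /rnorm normc_def /= expr0n expr1n add0r sqrtr1.
Qed.

Lemma rnorm_expB (a b : R[i]) n : rnorm a = 1 -> rnorm b = 1 ->
  rnorm (a ^+ n - b ^+ n) <= n%:R * rnorm (a - b).
Proof.
move=> a1 b1; elim: n => [|n IH]; first by rewrite subrr rnorm0 mul0r.
rewrite (_ : _ - _ = a * (a ^+ n - b ^+ n) + (a - b) * b ^+ n); last first.
  by rewrite !exprS mulrBr mulrBl addrA subrK.
rewrite (le_trans (rnormD _ _))// !rnormM rnormX a1 b1 expr1n mul1r mulr1.
by rewrite -natr1 mulrDl mul1r lerD2r.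
Qed.

Definition root_of_unity (L : nat) : R[i] := cis (pi *+ 2 / L%:R).

(** Orthogonality of characters: the sum is geometric with ratio [y = w ^ (a - b)], where
    [y ^ L = 1] and [y] differs from [1] unless [a = b]. *)
Lemma sum_root_of_unity L a b : (a < L)%N -> (b < L)%N ->
  \sum_(k < L) (root_of_unity L ^+ k) ^+ a * ((root_of_unity L ^+ k) ^+ b)^*%R =
  (if a == b then L%:R else 0).
Proof.
move=> aL bL; set w := root_of_unity L.
have L0 : (0 < L)%N by apply: leq_ltn_trans aL.
have LR : 0 < (L%:R : R) by rewrite ltr0n.
have w1 : rnorm w = 1 by exact: rnorm_cis.
have wX n : (w ^+ n)^*%R * w ^+ n = 1.
  by rewrite mulC_rnorm rnormX w1 expr1n expr1n.
have wL : w ^+ L = 1 by rewrite cisX mulrC divfK ?gt_eqF// cis2pi.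
pose y := w ^+ a * (w ^+ b)^*%R.
rewrite (eq_bigr (fun k : 'I_L => y ^+ k)); last first.
  by move=> k _; rewrite /y exprMn -rmorphXn -!exprM !(mulnC k).
have [ab|ab] := eqVneq a b.
  rewrite (eq_bigr (fun=> 1)) ?sumr_const ?card_ord// => k _.
  by rewrite /y ab mulrC wX expr1n.
have inj c d : (c < d)%N -> (d < L)%N -> w ^+ c != w ^+ d.
  move=> cd dL; apply/negP => /eqP cdE.
  have : w ^+ (d - c) = 1.
    rewrite -[LHS]mulr1 -[X in _ * X](wX c) mulrCA -exprD (subnK (ltnW cd)).
    by rewrite -cdE wX.
  apply/eqP; rewrite cisX; apply: cis_neq1.
  have pi2 : 0 < pi *+ 2 :> R by rewrite pmulrn_lgt0 ?pi_gt0.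
  rewrite mulr_gt0 ?ltr0n ?subn_gt0 ?divr_gt0//=.
  rewrite mulrA ltr_pdivrMr// mulrC ltr_pM2l// ltr_nat.
  by rewrite (leq_ltn_trans _ dL)// leq_subr.
have y1 : y != 1.
  apply/negP => /eqP yE; have : w ^+ a = w ^+ b.
    by rewrite -[LHS]mulr1 -[X in _ * X](wX b) mulrA -/y yE mul1r.
  apply/eqP; case: (ltngtP a b) ab => // h _; first exact: inj.
  by rewrite eq_sym inj.
have yL : y ^+ L = 1.
  rewrite /y exprMn -rmorphXn -!exprM !(mulnC _ L) (exprM _ L a) (exprM _ L b) wL.
  by rewrite !expr1n rmorph1 mulr1.
have := subrX1 y L; rewrite yL subrr => /esym/eqP.
by rewrite mulf_eq0 subr_eq0 (negPf y1) /= => /eqP.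
Qed.

End CirclePoints.

(** * Uniformity over the rotations *)

Section UniformErgodic.
Variables (R : realType) (H : completeNormedModType R[i]).
Variables (dot : {dot H for @Num.conj R[i]}) (dotE : norm_from_dot dot).
Variables (T : {linear H -> H}) (C : R) (C1 : 1 <= C).
Hypothesis Tpow : forall n u, rnorm (iter n T u) <= C * rnorm u.
Hypothesis noeig : forall (z : R[i]) u, rnorm z = 1 -> z *: T u = u -> u = 0.

Let C0 : 0 < C. Proof. exact: lt_le_trans C1. Qed.

(** Cut the sum into blocks of length [N1]. Each is the image of the first under some [z ^ a T ^ a],
    which costs a factor [C]; the incomplete last block is bounded trivially. *)
Lemma sum_rotated_block (z : R[i]) x (d : R) N1 N : rnorm z = 1 -> (0 < N1)%N ->
  0 <= d ->
  rnorm (\sum_(i < N1) z ^+ i *: iter i T x) <= d * N1%:R ->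
  rnorm (\sum_(i < N) z ^+ i *: iter i T x) <= C * d * N%:R + N1%:R * (C * rnorm x).
Proof.
move=> z1 N10 d0 hd.
have tail a b : \sum_(i < a + b) z ^+ i *: iter i T x =
    \sum_(i < a) z ^+ i *: iter i T x +
    z ^+ a *: iter a T (\sum_(i < b) z ^+ i *: iter i T x).
  rewrite big_split_ord /= iter_lin_sum scaler_sumr; congr (_ + _).
  by apply: eq_bigr => i _; rewrite iter_linZ scalerA exprD iterD.
have full q : rnorm (\sum_(i < q * N1) z ^+ i *: iter i T x) <=
    C * d * (q * N1)%:R.
  elim: q => [|q IH]; first by rewrite mul0n big_ord0 rnorm0 mulr0.
  rewrite mulSn addnC tail natrD mulrDr (le_trans (rnormD _ _))//.
  rewrite lerD// (le_trans (rnorm_rotated Tpow z1 _ _))// -mulrA.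
  by rewrite ler_wpM2l// ltW.
rewrite (divn_eq N N1) big_split_ord /= (le_trans (rnormD _ _))//.
rewrite lerD//.
  rewrite (le_trans (full _))// ler_wpM2l ?mulr_ge0 ?(ltW C0)//.
  by rewrite ler_nat leq_addr.
rewrite (le_trans (rnorm_sum _ _ _))//.
rewrite (le_trans (ler_sum _ (fun (i : 'I_(N %% N1)) _ => rnorm_rotated Tpow z1 _ _)))//.
rewrite sumr_const card_ord -[leLHS]mulr_natl ler_wpM2r ?mulr_ge0 ?(ltW C0) ?rnorm_ge0//.
by rewrite ler_nat ltnW// ltn_pmod.
Qed.

(** At a fixed [t], [mean_ergodic] gives one good length [N1]. A sum of fixed length depends
    continuously on the angle, so [N1] serves all nearby [s], and [sum_rotated_block] extends the
    bound to all large [N]. Compactness of [[0, 2 pi]] concludes. *)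
Lemma uniform_ergodic x (eps : R) : 0 < eps ->
  exists N0, forall N t, (N0 <= N)%N -> t \in `[0, pi *+ 2] ->
    rnorm (\sum_(i < N) cis t ^+ i *: iter i T x) <= eps * N%:R.
Proof.
move=> eps0.
pose P (N : nat) (t : R) :=
  rnorm (\sum_(i < N) cis t ^+ i *: iter i T x) <= eps * N%:R.
have cK : compact `[0, (pi *+ 2 : R)] by exact: segment_compact.
have := (compact_near_coveringP _).1 cK nat \oo P _.
case=> [t _|N0 _ hN0]; last first.
  by exists N0 => N t /hN0 h; rewrite inE => /h.
pose d := eps / (4 * C).
have d0 : 0 < d by rewrite divr_gt0// mulr_gt0.
have [N1 N10 hN1] := mean_ergodic dotE C1 Tpow (rnorm_cis t)
  (fun u => noeig (rnorm_cis t)) x d0.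
have N1R : 0 < N1%:R :> R by rewrite ltr0n.
pose X := C * rnorm x.
have X0 : 0 <= X by rewrite mulr_ge0 ?rnorm_ge0 ?(ltW C0).
(* Then [|cis s - cis t| <= 2 g], so each of the [N1] terms moves by at most [N1 * 2 g * X <= d] and
   the bound [d] becomes [2 d]; the choice of [d] makes [C * (2 * d) = eps / 2]. *)
pose g := d / (2 * (N1%:R * X + 1)).
have NX : 0 <= N1%:R * X by rewrite mulr_ge0.
have g0 : 0 < g by rewrite divr_gt0// mulr_gt0//; lra.
have [N2 hN2] : exists N2 : nat, 2 * (N1%:R * X) / eps <= N2%:R.
  by exists (Num.trunc (2 * (N1%:R * X) / eps)).+1; rewrite ltW// truncnS_gt.
exists ([set s | `|cos s - cos t| < g /\ `|sin s - sin t| < g], [set N | (N2 <= N)%N]).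
  split => /=; last by exists N2.
  apply: filterI.
    have /cvgrPdist_lt/(_ _ g0) := @continuous_cos R t.
    by apply: filterS => s; rewrite distrC.
  have /cvgrPdist_lt/(_ _ g0) := @continuous_sin R t.
  by apply: filterS => s; rewrite distrC.
case=> s N /= [[hc hs] N2N]; rewrite /P.
have cst : rnorm (cis s - cis t) <= d / (N1%:R * X + 1).
  rewrite (le_trans (rnorm_cisB _ _))// (le_trans (lerD (ltW hc) (ltW hs)))//.
  by rewrite /g le_eqVlt; apply/orP; left; apply/eqP; field; lra.
have hs1 : rnorm (\sum_(i < N1) cis s ^+ i *: iter i T x) <= (2 * d) * N1%:R.
  rewrite (_ : \sum_(i < N1) _ = \sum_(i < N1) cis t ^+ i *: iter i T x +
      \sum_(i < N1) (cis s ^+ i - cis t ^+ i) *: iter i T x); last first.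
    by rewrite -big_split /=; apply: eq_bigr => i _; rewrite -scalerDl subrKC.
  rewrite (le_trans (rnormD _ _))// mulrDl mulrDl !mul1r.
  rewrite lerD// (le_trans (rnorm_sum _ _ _))//.
  apply: (@le_trans _ _ (\sum_(i < N1) d)); last by rewrite sumr_const card_ord mulr_natr.
  apply: ler_sum => i _; rewrite rnormZ.
  have h1 := rnorm_expB i (rnorm_cis s) (rnorm_cis t).
  apply: (@le_trans _ _ ((N1%:R * (d / (N1%:R * X + 1))) * X)).
    apply: ler_pM; rewrite ?rnorm_ge0 ?Tpow//.
    rewrite (le_trans h1)// ler_pM ?rnorm_ge0//.
    by rewrite ler_nat ltnW.
  rewrite (_ : _ * X = d * ((N1%:R * X) / (N1%:R * X + 1))); last by field; lra.
  rewrite -[leRHS]mulr1 ler_pM2l// ler_pdivrMr; lra.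
have d20 : 0 <= 2 * d by rewrite mulr_ge0// ltW.
rewrite (le_trans (sum_rotated_block N (rnorm_cis s) N10 d20 hs1))// -/X.
have -> : C * (2 * d) = eps / 2 by rewrite /d; field; rewrite gt_eqF.
have : 2 * (N1%:R * X) <= N%:R * eps.
  rewrite -ler_pdivrMr// (le_trans hN2)// ler_nat//.
lra.
Qed.

End UniformErgodic.

(** * The window form and its correlations *)

Section WindowForm.
Variables (R : realType) (H : normedModType R[i]).
Variables (dot : {dot H for @Num.conj R[i]}) (dotE : norm_from_dot dot).
Variables (T : {linear H -> H}) (C : R) (C1 : 1 <= C).
Hypothesis Tpow : forall n u, rnorm (iter n T u) <= C * rnorm u.

Definition window_form (M : nat) (u v : H) : R[i] :=
  \sum_(m < M) dot (iter m T u) (iter m T v).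

Lemma dot_iter_le m n u v :
  rnorm (dot (iter m T u) (iter n T v)) <= (C * rnorm u) * (C * rnorm v).
Proof.
by rewrite (le_trans (cauchy_schwarz dotE _ _))// ler_pM ?rnorm_ge0 ?Tpow.
Qed.

Lemma window_form_le M u v :
  rnorm (window_form M u v) <= M%:R * ((C * rnorm u) * (C * rnorm v)).
Proof.
rewrite (le_trans (rnorm_sum _ _ _))//.
rewrite (le_trans (ler_sum _ (fun (m : 'I_M) _ => dot_iter_le m m u v)))//.
by rewrite sumr_const card_ord mulr_natl.
Qed.

Lemma window_form_suml M (I : Type) (r : seq I) (P : pred I) (c : I -> R[i])
    (F : I -> H) v :
  window_form M (\sum_(i <- r | P i) c i *: F i) v =
  \sum_(i <- r | P i) c i * window_form M (F i) v.
Proof.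
rewrite /window_form.
under eq_bigr do rewrite iter_lin_sum dot_suml.
rewrite exchange_big /=; apply: eq_bigr => i _; rewrite mulr_sumr.
by apply: eq_bigr => m _; rewrite iter_linZ dotZl.
Qed.

(** Each further power of [T] moves the window by one index: one term enters and one leaves. Hence
    an error independent of [M]. *)
Lemma window_form_shift M r u v :
  rnorm (window_form M (iter r T u) (iter r T v) - window_form M u v) <=
  (2 * r)%:R * ((C * rnorm u) * (C * rnorm v)).
Proof.
pose g m := dot (iter m T u) (iter m T v).
have -> : window_form M (iter r T u) (iter r T v) = \sum_(m < M) g (m + r)%N.
  by apply: eq_bigr => m _; rewrite -!iterD.
rewrite /window_form -/g; elim: r => [|r IH].
  by under eq_bigr do rewrite addn0; rewrite subrr rnorm0 mul0r.
have -> : \sum_(m < M) g (m + r.+1)%N - \sum_(m < M) g m =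
    (\sum_(m < M) g (m + r)%N - \sum_(m < M) g m) + (g (M + r)%N - g r).
  rewrite addrAC; congr (_ - _); rewrite -[g r]/(g (0 + r)%N).
  rewrite -(telescope_sumr (fun m => g (m + r)%N) (leq0n M)) big_mkord -big_split /=.
  by apply: eq_bigr => m _; rewrite addSn addnS subrKC.
rewrite (le_trans (rnormD _ _))// mulnS natrD mulrDl [leRHS]addrC lerD//.
by rewrite mulr_natl mulr2n (le_trans (rnormB _ _))// lerD// dot_iter_le.
Qed.

End WindowForm.

Section Correlations.
Variables (R : realType) (H : completeNormedModType R[i]).
Variables (dot : {dot H for @Num.conj R[i]}) (dotE : norm_from_dot dot).
Variables (T : {linear H -> H}) (C : R) (C1 : 1 <= C).
Hypothesis Tpow : forall n u, rnorm (iter n T u) <= C * rnorm u.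
Hypothesis noeig : forall (z : R[i]) u, rnorm z = 1 -> z *: T u = u -> u = 0.

Let C0 : 0 < C. Proof. exact: lt_le_trans C1. Qed.

(* A discrete Herglotz representation: the truncated correlations are the
   Fourier coefficients of a positive measure on the roots of unity. *)
Lemma herglotz (M n : nat) x : (n <= M)%N ->
  let w := root_of_unity R (2 * M) in
  \sum_(k < 2 * M) (w ^+ k) ^+ n *
     ((rnorm (\sum_(m < M) (w ^+ k) ^+ m *: iter m T x)) ^+ 2)%:C =
  (2 * M)%:R * \sum_(m < M | (m + n < M)%N) dot (iter m T x) (iter (m + n) T x).
Proof.
move=> nM w.
under eq_bigr => k _.
  rewrite -(dotxx dotE) dot_suml mulr_sumr.
  under eq_bigr => m _.
    rewrite dotZl dot_sumr !mulr_sumr.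
    under eq_bigr => l _.
      rewrite dotZr (_ : _ * _ = (w ^+ k) ^+ (n + m) * ((w ^+ k) ^+ l)^*%R *
         dot (iter m T x) (iter l T x)); last by rewrite exprD; ring.
      over.
    over.
  over.
rewrite exchange_big /= mulr_sumr [RHS]big_mkcond /=; apply: eq_bigr => m _.
rewrite exchange_big /=.
(* Both exponents [n + m] and [l] are below [2 * M], so orthogonality leaves only [l = n + m],
   without wrap-around; this is why [2 * M] roots are taken. *)
under eq_bigr => l _.
  rewrite -mulr_suml sum_root_of_unity; last 2 first.
  - by have := ltn_ord m; lia.
  - by have := ltn_ord l; lia.
  over.
case: ifPn => [mn|mn]; last first.
  rewrite big1// => l _; case: eqP => [E|]; last by rewrite mul0r.
  by have := ltn_ord l; rewrite -E addnC => h; rewrite h in mn.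
rewrite (bigD1 (Ordinal mn)) //= addnC eqxx big1 ?addr0// => l ln.
case: eqP => [E|]; last by rewrite mul0r.
by case/negP: ln; apply/eqP/val_inj; rewrite /= addnC -E addnC.
Qed.

(** Let [beta n] be the correlations and [phi n] the truncations of their conjugates. Write
    [|beta n|^2] as [phi n * beta n] plus an error. The first part sums to the window form of
    [\sum phi n T ^ n x] against [x], and by [herglotz] that vector is a positive combination of
    rotated sums. The error is small because truncation drops only [n] terms. *)
Lemma correlation_le M N x (eps : R) : (N <= M)%N ->
  (forall t, t \in `[0, pi *+ 2] ->
    rnorm (\sum_(i < N) cis t ^+ i *: iter i T x) <= eps * N%:R) ->
  \sum_(n < N) rnorm (window_form dot T M (iter n T x) x) ^+ 2 <=
  M%:R ^+ 2 * N%:R * eps * C * (C * rnorm x) ^+ 3 +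
  N%:R ^+ 2 * M%:R * (C * rnorm x) ^+ 4.
Proof.
move=> NM hN; set X := C * rnorm x.
have [->|M0] := posnP M.
  rewrite big1 => [|n _]; first by rewrite expr0n/= !mul0r mulr0 mul0r addr0.
  by rewrite /window_form big_ord0 rnorm0 expr0n.
have X0 : 0 <= X by rewrite mulr_ge0 ?rnorm_ge0 ?(ltW C0).
pose phi n := \sum_(m < M | (m + n < M)%N) dot (iter m T x) (iter (m + n) T x).
pose beta n := window_form dot T M (iter n T x) x.
have beta_le n : rnorm (beta n) <= M%:R * X ^+ 2.
  rewrite /beta /window_form (le_trans (rnorm_sum _ _ _))//.
  apply: (@le_trans _ _ (\sum_(m < M) X ^+ 2)).
    by apply: ler_sum => m _; rewrite -iterD expr2 dot_iter_le.
  by rewrite sumr_const card_ord mulr_natl.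
have diff_le n : rnorm ((beta n)^*%R - phi n) <= n%:R * X ^+ 2.
  have -> : (beta n)^*%R - phi n =
      \sum_(m < M | (M <= m + n)%N) dot (iter m T x) (iter (m + n) T x).
    rewrite rmorph_sum /= (bigID (fun m : 'I_M => (m + n < M)%N)) /=.
    under [in X in X + _ - _]eq_bigr do rewrite -dotC -iterD.
    rewrite addrAC subrr add0r; apply: eq_big => m; first by rewrite -leqNgt.
    by move=> _; rewrite -dotC -iterD.
  rewrite (le_trans (rnorm_sum _ _ _))//.
  apply: (@le_trans _ _ (\sum_(m < M | (M <= m + n)%N) X ^+ 2)).
    by apply: ler_sum => m _; rewrite expr2 dot_iter_le.
  rewrite sumr_const -[leLHS]mulr_natl ler_wpM2r ?exprn_ge0// ler_nat.
  rewrite -sum1_card -(big_mkord (fun m => M <= m + n)%N (fun=> 1%N)).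
  rewrite (eq_bigl (fun m => true && (M - n <= m)%N)); last by move=> m; rewrite leq_subLR addnC.
  by rewrite -big_nat_widenl//= sum_nat_const_nat; lia.
have sum_phi : rnorm (\sum_(n < N) phi n *: iter n T x) <= M%:R * X ^+ 2 * (eps * N%:R).
  pose w := root_of_unity R (2 * M).
  pose Y k := rnorm (\sum_(m < M) (w ^+ k) ^+ m *: iter m T x) ^+ 2.
  have phiE n : (n <= M)%N ->
      (2 * M)%:R * phi n = \sum_(k < 2 * M) (w ^+ k) ^+ n * (Y k)%:C.
    by move=> nM; rewrite herglotz.
  have M2 : 0 < (2 * M)%:R :> R by rewrite ltr0n muln_gt0.
  rewrite -(ler_pM2l M2).
  have -> : (2 * M)%:R * rnorm (\sum_(n < N) phi n *: iter n T x) =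
      rnorm (\sum_(k < 2 * M) (Y k)%:C *: \sum_(n < N) (w ^+ k) ^+ n *: iter n T x).
    rewrite -[X in X * _]gtr0_norm// -rnorm_real -rnormZ rmorph_nat.
    congr rnorm; rewrite scaler_sumr; under [RHS]eq_bigr do rewrite scaler_sumr.
    rewrite exchange_big /=; apply: eq_bigr => n _.
    rewrite scalerA phiE; last by have := ltn_ord n; lia.
    by rewrite scaler_suml; apply: eq_bigr => k _; rewrite scalerA mulrC.
  rewrite (le_trans (rnorm_sum _ _ _))//.
  apply: (@le_trans _ _ (\sum_(k < 2 * M) Y k * (eps * N%:R))).
    apply: ler_sum => k _; rewrite rnormZ rnorm_real ger0_norm ?exprn_ge0 ?rnorm_ge0//.
    rewrite ler_wpM2l ?exprn_ge0 ?rnorm_ge0// cisX hN// in_itv /=.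
    have pi2 : 0 < pi *+ 2 :> R by rewrite pmulrn_lgt0 ?pi_gt0.
    rewrite mulr_ge0 ?divr_ge0 ?(ltW pi2)//= mulrA ler_pdivrMr// mulrC ler_pM2l//.
    by rewrite ler_nat ltnW.
  rewrite -mulr_suml [leRHS]mulrA ler_wpM2r//.
    have t0 : (0 : R) \in `[0, pi *+ 2] by rewrite in_itv /= lexx mulrn_wge0 ?pi_ge0.
    by rewrite (le_trans (rnorm_ge0 _) (hN 0 t0)).
  (* The total mass of the measure is its Fourier coefficient at [0]. *)
  have Y0 : (\sum_(k < 2 * M) Y k)%:C = (2 * M)%:R * phi 0%N.
    by rewrite phiE// rmorph_sum; apply: eq_bigr => k _; rewrite expr0 mul1r.
  have Y00 : 0 <= \sum_(k < 2 * M) Y k by apply: sumr_ge0 => k _; rewrite exprn_ge0 ?rnorm_ge0.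
  rewrite -[leLHS]ger0_norm// -rnorm_real Y0 rnormM.
  have -> : rnorm ((2 * M)%:R : R[i]) = (2 * M)%:R.
    by rewrite -(rmorph_nat (real_complex R)) rnorm_real ger0_norm.
  rewrite ler_pM2l// (le_trans (rnorm_sum _ _ _))//.
  rewrite (eq_bigl xpredT) => [|m]; last by rewrite addn0 ltn_ord.
  apply: (@le_trans _ _ (\sum_(m < M) X ^+ 2)).
    by apply: ler_sum => m _; rewrite expr2 dot_iter_le.
  by rewrite sumr_const card_ord mulr_natl.
have main : rnorm (\sum_(n < N) phi n * beta n) <= M%:R ^+ 2 * N%:R * eps * C * X ^+ 3.
  rewrite /beta -window_form_suml (le_trans (window_form_le dotE Tpow _ _ _))//.
  rewrite -/X [leRHS](_ : _ = M%:R * (C * (M%:R * X ^+ 2 * (eps * N%:R)) * X)); last by ring.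
  by rewrite ler_wpM2l// ler_wpM2r// ler_wpM2l// ltW.
have E : \sum_(n < N) rnorm (beta n) ^+ 2 =
    complex.Re (\sum_(n < N) phi n * beta n + \sum_(n < N) ((beta n)^*%R - phi n) * beta n).
  rewrite -big_split /=.
  under [in RHS]eq_bigr do rewrite -mulrDl subrKC mulC_rnorm.
  by rewrite -rmorph_sum.
rewrite E (le_trans (Re_le_rnorm _))// (le_trans (rnormD _ _))// lerD//.
rewrite (le_trans (rnorm_sum _ _ _))//.
apply: (@le_trans _ _ (\sum_(n < N) N%:R * X ^+ 2 * (M%:R * X ^+ 2))).
  apply: ler_sum => n _; rewrite rnormM ler_pM ?rnorm_ge0//.
  by rewrite (le_trans (diff_le n))// ler_wpM2r ?exprn_ge0// ler_nat ltnW.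
by rewrite sumr_const card_ord -[leLHS]mulr_natl le_eqVlt; apply/orP; left; apply/eqP; ring.
Qed.

(** [correlation_le] controls squares; [b <= (b^2 / (eps M) + eps M) / 2] passes to first powers.
    The window [M] is chosen after [N] because the second term of [correlation_le] is negligible
    only for [M] large compared with [N]. *)
Lemma correlation_null x (eps : R) : 0 < eps ->
  exists N0, forall N, (N0 <= N)%N -> exists M0, forall M, (M0 <= M)%N ->
  \sum_(n < N) rnorm (window_form dot T M (iter n T x) x) <= eps * N%:R * M%:R.
Proof.
move=> eps0; pose X := C * rnorm x.
have X0 : 0 <= X by rewrite mulr_ge0 ?rnorm_ge0 ?(ltW C0).
have X3 : 0 <= C * X ^+ 3 by rewrite mulr_ge0 ?exprn_ge0 ?(ltW C0).
pose d := eps ^+ 2 / (2 * (C * X ^+ 3 + 1)).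
have d0 : 0 < d by rewrite divr_gt0 ?exprn_gt0// mulr_gt0//; lra.
have dX : d * (C * X ^+ 3) <= eps ^+ 2 / 2.
  rewrite (_ : d * _ = eps ^+ 2 / 2 * ((C * X ^+ 3) / (C * X ^+ 3 + 1))); last first.
    by rewrite /d; field; lra.
  rewrite -[leRHS]mulr1 ler_wpM2l ?divr_ge0 ?exprn_ge0 ?(ltW eps0)//.
  by rewrite ler_pdivrMr; lra.
have [N0 hN0] := uniform_ergodic dotE C1 Tpow noeig x d0.
exists N0 => N N0N.
pose M0 := (Num.trunc (2 * N%:R * X ^+ 4 / eps ^+ 2)).+1.
exists (maxn N M0) => M; rewrite geq_max => /andP[NM M0M].
have MX : 2 * N%:R * X ^+ 4 <= M%:R * eps ^+ 2.
  rewrite -ler_pdivrMr ?exprn_gt0//.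
  rewrite (le_trans (ltW (truncnS_gt _)))// ler_nat//.
have M0' : 0 < M%:R :> R by rewrite ltr0n (leq_trans _ M0M).
have := correlation_le NM (fun t => hN0 N t N0N); rewrite -/X => h.
have eM : 0 < eps * M%:R by rewrite mulr_gt0.
apply: (@le_trans _ _ (\sum_(n < N)
    (rnorm (window_form dot T M (iter n T x) x) ^+ 2 / (eps * M%:R) + eps * M%:R) / 2)).
  apply: ler_sum => n _; set b := rnorm _.
  rewrite ler_pdivlMr// -subr_ge0.
  rewrite (_ : _ - _ = (b - eps * M%:R) ^+ 2 / (eps * M%:R)); last by field; rewrite !gt_eqF.
  by rewrite divr_ge0 ?sqr_ge0// ltW.
rewrite -mulr_suml big_split /= -mulr_suml sumr_const card_ord -[_ *+ N]mulr_natl.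
have : (\sum_(i < N) rnorm (window_form dot T M (iter i T x) x) ^+ 2) / (eps * M%:R) <=
    N%:R * (eps * M%:R).
  rewrite ler_pdivrMr// (le_trans h)//.
  have n0 : 0 <= N%:R * M%:R ^+ 2 :> R by rewrite mulr_ge0 ?exprn_ge0.
  have n1 : 0 <= N%:R * M%:R :> R by rewrite mulr_ge0.
  have := ler_wpM2l n0 dX; have := ler_wpM2l n1 MX; lra.
lra.
Qed.

End Correlations.

(** * The van der Corput inequality *)

(** The tail has length [L * J] close to [N / k.+2]: short relative to the head [p], yet a fixed
    proportion of it. It drives the induction in [vdc]. *)
Lemma split_block k J N : (0 < J)%N -> (J * k.+2 <= N)%N -> exists p L,
  [/\ N = p + L * J, p < N, N <= 2 * p, k.+1 * (L * J) <= p &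
      p <= 2 * k.+2 * (L * J)]%N.
Proof.
move=> J0 JN; pose L := (N %/ (J * k.+2))%N.
have JK0 : (0 < J * k.+2)%N by rewrite muln_gt0 J0.
have L0 : (0 < L)%N by rewrite divn_gt0.
have Lle : (L * J * k.+2 <= N)%N by rewrite -mulnA leq_divM.
have Lge : (N < (L * J + J) * k.+2)%N by rewrite addnC -mulSn -mulnA ltn_ceil.
have JL : (J <= L * J)%N by rewrite leq_pmull.
exists (N - L * J)%N, L; move: Lle Lge JL J0; move: (L * J)%N => y; clear.
by move=> Lle Lge JL J0; split; nia.
Qed.

Section VanDerCorput.
Variables (R : realType) (H : normedModType R[i]).
Variables (dot : {dot H for @Num.conj R[i]}) (dotE : norm_from_dot dot).
Variables (T : {linear H -> H}) (C : R) (C1 : 1 <= C).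
Hypothesis Tpow : forall n u, rnorm (iter n T u) <= C * rnorm u.
Variable x : H.

Let C0 : 0 < C. Proof. exact: lt_le_trans C1. Qed.
Let X := C * rnorm x.
Let X0 : 0 <= X. Proof. by rewrite mulr_ge0 ?rnorm_ge0 ?(ltW C0). Qed.

Definition unif_null (a : nat -> nat) : Prop :=
  forall eps : R, 0 < eps -> exists N0, forall N, (N0 <= N)%N ->
  forall c : nat -> R[i], (forall n, rnorm (c n) <= 1) ->
  rnorm (\sum_(n < N) c n *: iter (a n) T x) <= eps * N%:R.

Definition corr (W d : nat) : R := rnorm (window_form dot T W (iter d T x) x).

Lemma corr_ge0 W d : 0 <= corr W d. Proof. exact: rnorm_ge0. Qed.

Lemma sum_scale_le (a : nat -> nat) (c : nat -> R[i]) n :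
  (forall n, rnorm (c n) <= 1) ->
  rnorm (\sum_(i < n) c i *: iter (a i) T x) <= n%:R * X.
Proof.
move=> c1; rewrite (le_trans (rnorm_sum _ _ _))//.
apply: (@le_trans _ _ (\sum_(i < n) X)); last by rewrite sumr_const card_ord mulr_natl.
by apply: ler_sum => i _; rewrite rnormZ -[leRHS]mul1r ler_pM ?rnorm_ge0.
Qed.

(** The form is Hermitian, so [v <= u] may be assumed; the common power [T ^ v] is then removed by
    [window_form_shift] at a cost independent of [W]. *)
Lemma window_pair_le W u v r : (minn u v <= r)%N ->
  rnorm (window_form dot T W (iter u T x) (iter v T x)) <=
  corr W (maxn u v - minn u v) + 2 * r%:R * (C * X ^+ 2).
Proof.
have sym s t : rnorm (window_form dot T W s t) = rnorm (window_form dot T W t s).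
  rewrite -rnorm_conj rmorph_sum /=; congr rnorm; apply: eq_bigr => m _.
  by rewrite -dotC.
wlog vu : u v / (v <= u)%N.
  move=> h; have [vu|uv] := orP (leq_total v u); first exact: h.
  by rewrite minnC maxnC sym; apply: h.
rewrite (minn_idPr vu) (maxn_idPl vu) => vr.
have -> : iter u T x = iter v T (iter (u - v) T x) by rewrite -iterD subnKC.
rewrite -[X in rnorm X](subrK (window_form dot T W (iter (u - v) T x) x)).
rewrite (le_trans (rnormD _ _))// addrC lerD2l.
rewrite (le_trans (window_form_shift dotE Tpow _ _ _ _))// natrM.
rewrite -/X (_ : C * X ^+ 2 = (C * X) * X); last by rewrite expr2 mulrA.
rewrite ler_pM ?mulr_ge0 ?rnorm_ge0 ?(ltW C0)//.
  by rewrite ler_wpM2l// ler_nat.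
by rewrite ler_wpM2r// ler_wpM2l ?(ltW C0)// Tpow.
Qed.

(* Writing [T ^ a] as [T ^ (W - m)] applied to [T ^ (a - W + m)] and averaging
   over [m < W] brings in the window form. *)
Lemma window_average (W J : nat) (e : nat -> nat) (c : nat -> R[i]) r :
  (forall j, rnorm (c j) <= 1) -> (forall j, (j < J)%N -> (e j <= r)%N) ->
  W%:R * rnorm (\sum_(j < J) c j *: iter (W + e j) T x) ^+ 2 <=
  C ^+ 2 * (\sum_(j < J) \sum_(l < J) corr W (maxn (e j) (e l) - minn (e j) (e l)) +
            J%:R ^+ 2 * (2 * r%:R * (C * X ^+ 2))).
Proof.
move=> c1 er; pose w := \sum_(j < J) c j *: iter (e j) T x.
have vE m : (m < W)%N ->
    \sum_(j < J) c j *: iter (W + e j) T x = iter (W - m) T (iter m T w).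
  move=> mW; rewrite -iterD (subnK (ltnW mW)) iter_lin_sum.
  by apply: eq_bigr => j _; rewrite iter_linZ iterD.
apply: (@le_trans _ _ (C ^+ 2 * rnorm (window_form dot T W w w))).
  apply: (@le_trans _ _ (C ^+ 2 * \sum_(m < W) rnorm (iter m T w) ^+ 2)).
    rewrite mulr_sumr mulr_natl -[X in _ *+ X](card_ord W) -sumr_const.
    apply: ler_sum => m _; rewrite (vE m (ltn_ord m)) -exprMn lerXn2r ?nnegrE ?rnorm_ge0//.
    by rewrite mulr_ge0 ?rnorm_ge0 ?(ltW C0).
  rewrite ler_wpM2l ?exprn_ge0 ?(ltW C0)// (le_trans _ (Re_le_rnorm _))//.
  rewrite /window_form; under [in leRHS]eq_bigr do rewrite (dotxx dotE).
  by rewrite -rmorph_sum.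
rewrite ler_wpM2l ?exprn_ge0 ?(ltW C0)//.
rewrite {1}/w window_form_suml (le_trans (rnorm_sum _ _ _))//.
rewrite expr2 -mulrA mulr_natl -[X in _ *+ X](card_ord J) -sumr_const -big_split /=.
apply: ler_sum => j _.
rewrite mulr_natl -[X in _ *+ X](card_ord J) -sumr_const -big_split /=.
rewrite rnormM -[leRHS]mul1r ler_pM ?rnorm_ge0//.
have -> : window_form dot T W (iter (e j) T x) w =
    \sum_(l < J) (c l)^*%R * window_form dot T W (iter (e j) T x) (iter (e l) T x).
  rewrite /window_form; under eq_bigr do rewrite iter_lin_sum dot_sumr.
  rewrite exchange_big /=; apply: eq_bigr => l _; rewrite mulr_sumr.
  by apply: eq_bigr => m _; rewrite iter_linZ dotZr.
rewrite (le_trans (rnorm_sum _ _ _))//; apply: ler_sum => l _.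
rewrite rnormM rnorm_conj -[leRHS]mul1r ler_pM ?rnorm_ge0//.
by rewrite window_pair_le// geq_min er.
Qed.

(** The block after [p] is cut into [L] groups of [J] indices, with correlations inside each group.
    The window [a p] is the least exponent when [a] is nondecreasing from [p] on, so
    [window_average] applies to every group. *)
Definition pair_corr (a : nat -> nat) (p J L : nat) : R :=
  \sum_(i < L) \sum_(j < J) \sum_(l < J)
    corr (a p) (maxn (a (p + i * J + j)%N) (a (p + i * J + l)%N) -
                minn (a (p + i * J + j)%N) (a (p + i * J + l)%N)).

(** Apply [window_average] to each group with [W = a p]. In the hypothesis on [d], the [1] accounts
    for the pair correlations and [2 * (C * X ^+ 2)] for the shift errors, as exponents exceed [W]
    by at most [d * W]. Summing squares over the groups and using the inequality of means gives the
    linear bound. *)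
Lemma vdc_block (a : nat -> nat) (p J L : nat) (c : nat -> R[i]) (eps d : R) :
  0 < eps -> C ^+ 2 * (1 + 2 * (C * X ^+ 2)) * d <= eps ^+ 2 ->
  (0 < J)%N -> (0 < a p)%N ->
  (forall n m, (p <= n)%N -> (n <= m)%N -> (a n <= a m)%N) ->
  (a (p + L * J) - a p)%N%:R <= d * (a p)%:R ->
  pair_corr a p J L <= d * (a p)%:R * J%:R ^+ 2 * L%:R ->
  (forall n, rnorm (c n) <= 1) ->
  rnorm (\sum_(n < L * J) c n *: iter (a (p + n)%N) T x) <= eps * (L * J)%:R.
Proof.
move=> eps0 deps J0 W0 mono slow pairs c1.
pose v i := \sum_(j < J) c (i * J + j)%N *: iter (a (p + i * J + j)%N) T x.
have SE : \sum_(n < L * J) c n *: iter (a (p + n)%N) T x = \sum_(i < L) v i.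
  rewrite -(big_mkord xpredT (fun n => c n *: iter (a (p + n)%N) T x)) big_nat_mul big_mkord.
  apply: eq_bigr => i _; rewrite -{1}[(i * J)%N]add0n mulSn big_addn addnK big_mkord.
  by apply: eq_bigr => j _; rewrite addnC -addnA.
set W := a p in W0 slow pairs *.
have WR : 0 < W%:R :> R by rewrite ltr0n.
have JR : 0 < J%:R :> R by rewrite ltr0n.
set r := (a (p + L * J) - W)%N in slow.
pose sq i : R := \sum_(j < J) \sum_(l < J)
    corr W (maxn (a (p + i * J + j)%N) (a (p + i * J + l)%N) -
            minn (a (p + i * J + j)%N) (a (p + i * J + l)%N)).
have vle i : (i < L)%N -> W%:R * rnorm (v i) ^+ 2 <=
    C ^+ 2 * (sq i + J%:R ^+ 2 * (2 * r%:R * (C * X ^+ 2))).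
  move=> iL; pose e j := (a (p + i * J + j) - W)%N.
  have aE j : a (p + i * J + j)%N = (W + e j)%N.
    by rewrite subnKC// mono// -addnA leq_addr.
  have := @window_average W J e (fun j => c (i * J + j)%N) r (fun j => c1 _) _.
  rewrite /sq /v; under eq_bigr do rewrite -aE.
  have dE j l : (maxn (a (p + i * J + j)%N) (a (p + i * J + l)%N) -
            minn (a (p + i * J + j)%N) (a (p + i * J + l)%N) =
      maxn (e j) (e l) - minn (e j) (e l))%N.
    by rewrite !aE -addn_maxr -addn_minr subnDl.
  under [in X in _ -> _ <= C ^+ 2 * (X + _)]eq_bigr do under eq_bigr do rewrite dE.
  have iLJ : (i * J + J <= L * J)%N by rewrite addnC -mulSn leq_mul2r iL orbT.
  apply => j jJ; rewrite leq_sub2r// mono -?addnA ?leq_addr// leq_add2l.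
  by rewrite (leq_trans _ iLJ)// leq_add2l ltnW.
have sum_sq : \sum_(i < L) rnorm (v i) ^+ 2 <= eps ^+ 2 * J%:R ^+ 2 * L%:R.
  rewrite -(ler_pM2l WR) mulr_sumr.
  apply: (le_trans (ler_sum _ (fun (i : 'I_L) _ => vle i (ltn_ord i)))).
  rewrite -mulr_sumr big_split /= sumr_const card_ord -[_ *+ L]mulr_natl.
  have n0 : 0 <= J%:R ^+ 2 * L%:R * W%:R :> R by rewrite !mulr_ge0 ?exprn_ge0.
  have n1 : 0 <= C ^+ 2 by rewrite exprn_ge0// ltW.
  have n2 : 0 <= C ^+ 2 * (L%:R * (J%:R ^+ 2 * (2 * (C * X ^+ 2)))) :> R.
    by rewrite !mulr_ge0 ?exprn_ge0 ?(ltW C0) ?mulr_ge0 ?rnorm_ge0 ?(ltW C0).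
  have h1 := ler_wpM2l n0 deps; have h2 := ler_wpM2l n1 pairs.
  have h3 := ler_wpM2l n2 slow.
  have -> : \sum_(i < L) sq i = pair_corr a p J L by [].
  lra.
rewrite SE (le_trans (rnorm_sum _ _ _))//.
have eJ : 0 < eps * J%:R by rewrite mulr_gt0.
apply: (@le_trans _ _ (\sum_(i < L)
    (rnorm (v i) ^+ 2 / (eps * J%:R) + eps * J%:R) / 2)).
  apply: ler_sum => i _; set b := rnorm _.
  rewrite ler_pdivlMr// -subr_ge0.
  rewrite (_ : _ - _ = (b - eps * J%:R) ^+ 2 / (eps * J%:R)); last by field; rewrite !gt_eqF.
  by rewrite divr_ge0 ?sqr_ge0// ltW.
rewrite -mulr_suml big_split /= -mulr_suml sumr_const card_ord -[_ *+ L]mulr_natl natrM.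
have : (\sum_(i < L) rnorm (v i) ^+ 2) / (eps * J%:R) <= eps * (L%:R * J%:R).
  by rewrite ler_pdivrMr// (le_trans sum_sq)//; lra.
lra.
Qed.

(** Strong induction on [N]: [split_block] cuts off a tail on which [a] hardly grows, [vdc_block]
    bounds the tail by [eps / 2] per term, and the head is the induction hypothesis. Short sums
    contribute the constant [N1 * X], absorbed for large [N]. *)
Lemma vdc (a : nat -> nat) n0 :
  (forall n m, (n0 <= n)%N -> (n <= m)%N -> (a n <= a m)%N) ->
  (forall n, (n0 <= n)%N -> (0 < a n)%N) ->
  (forall d : R, 0 < d -> exists k P0, forall p q,
    (P0 <= p)%N -> (p <= q)%N -> (k * (q - p) <= p)%N ->
    (a q - a p)%N%:R <= d * (a p)%:R) ->
  (forall d : R, 0 < d -> exists2 J, (0 < J)%N & forall k, exists P0, forall p L,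
    (P0 <= p)%N -> (p <= k * (L * J))%N -> (L * J <= p)%N ->
    pair_corr a p J L <= d * (a p)%:R * J%:R ^+ 2 * L%:R) ->
  unif_null a.
Proof.
move=> mono pos slow pairs eps eps0.
pose K := C ^+ 2 * (1 + 2 * (C * X ^+ 2)).
have K0 : 0 < K.
  rewrite mulr_gt0 ?exprn_gt0//.
  have : 0 <= C * X ^+ 2 by rewrite mulr_ge0 ?exprn_ge0// ltW.
  lra.
pose d := (eps / 2) ^+ 2 / K.
have e20 : 0 < eps / 2 by rewrite divr_gt0.
have d0 : 0 < d by rewrite divr_gt0// exprn_gt0.
have Kd : K * d <= (eps / 2) ^+ 2 by rewrite mulrC divfK// gt_eqF.
have [J J0 hJ] := pairs d d0.
have [k [P1 hk]] := slow d d0.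
have [P2 hP2] := hJ (2 * k.+2)%N.
pose N1 := (2 * (n0 + P1 + P2) + J * k.+2)%N.
have claim N : forall c : nat -> R[i], (forall n, rnorm (c n) <= 1) ->
    rnorm (\sum_(n < N) c n *: iter (a n) T x) <= N1%:R * X + eps / 2 * N%:R.
  elim/ltn_ind: N => N IH c c1.
  have [NN1|N1N] := ltnP N N1.
    rewrite (le_trans (sum_scale_le _ _ c1))// -[leLHS]addr0 lerD//.
      by rewrite ler_wpM2r// ler_nat ltnW.
    by rewrite mulr_ge0// ltW.
  have JN : (J * k.+2 <= N)%N by rewrite (leq_trans _ N1N)// leq_addl.
  have [p [L [NE pN p2 kLp pkL]]] := split_block J0 JN.
  have [n0p P1p P2p] : [/\ n0 <= p, P1 <= p & P2 <= p]%N.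
    by move: N1N p2; rewrite /N1; move: (J * k.+2)%N; clear; split; lia.
  have SE : \sum_(n < N) c n *: iter (a n) T x = \sum_(n < p) c n *: iter (a n) T x +
      \sum_(n < L * J) c (p + n)%N *: iter (a (p + n)%N) T x.
    by rewrite [in LHS]NE big_split_ord.
  have NR : N%:R = p%:R + (L * J)%:R :> R by rewrite -natrD -NE.
  rewrite SE (le_trans (rnormD _ _))// NR mulrDr addrA lerD//.
    exact: IH.
  apply: (@vdc_block a p J L (fun n => c (p + n)%N) _ d) => //.
  - exact: pos.
  - by move=> n m pn; apply: mono; exact: leq_trans pn.
  - by apply: hk; rewrite ?leq_addr ?addKn// (leq_trans _ kLp)// leq_mul2r leqW ?orbT.
  - by apply: hP2 => //; rewrite (leq_trans _ kLp)// leq_pmull.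
have [N2 hN2] : exists N2 : nat, N1%:R * X / (eps / 2) <= N2%:R.
  by exists (Num.trunc (N1%:R * X / (eps / 2))).+1; rewrite ltW// truncnS_gt.
exists N2 => N N2N c c1; rewrite (le_trans (claim N c c1))//.
have : N1%:R * X <= N%:R * (eps / 2).
  by rewrite -ler_pdivrMr// (le_trans hN2)// ler_nat.
lra.
Qed.

End VanDerCorput.

(** * Sums of nonnegative terms and polar decomposition *)

Section NonnegSums.
Variable R : realType.
Implicit Type F : nat -> R.

Lemma ler_sum_prefix F a b : (forall n, 0 <= F n) -> (a <= b)%N ->
  \sum_(n < a) F n <= \sum_(n < b) F n.
Proof.
move=> F0 ab; rewrite -(subnKC ab) big_split_ord /= lerDl.
by apply: sumr_ge0.
Qed.

(** For fixed [j], each distance to [j] is attained by at most two indices [l]. *)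
Lemma ler_sum_dist F J j : (forall n, 0 <= F n) -> (j < J)%N ->
  \sum_(l < J) F (maxn j l - minn j l)%N <= 2 * \sum_(n < J) F n.
Proof.
move=> F0 jJ; rewrite mulr_natl mulr2n.
have -> : \sum_(l < J) F (maxn j l - minn j l)%N =
    \sum_(l < j) F (j - l)%N + \sum_(l < J - j) F l.
  rewrite -[in LHS](subnKC (ltnW jJ)) big_split_ord /=; congr (_ + _).
    by apply: eq_bigr => l _; congr F; have := ltn_ord l; lia.
  by apply: eq_bigr => l _; congr F; lia.
rewrite lerD//; last by rewrite ler_sum_prefix// leq_subr.
rewrite (reindex_inj rev_ord_inj) /=.
rewrite (eq_bigr (fun l : 'I_j => F l.+1)) => [|l _]; last first.
  by congr F; have := ltn_ord l; lia.
apply: (@le_trans _ _ (\sum_(l < j.+1) F l)); last exact: ler_sum_prefix.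
by rewrite big_ord_recl /= lerDr.
Qed.

Lemma ler_sum_progression F p J L : (forall n, 0 <= F n) -> (0 < J)%N ->
  \sum_(i < L) F (p + i * J)%N <= \sum_(n < p + L * J) F n.
Proof.
move=> F0 J0; elim: L => [|L IH]; first by rewrite big_ord0 sumr_ge0.
rewrite big_ord_recr /= mulSn [(J + _)%N]addnC addnA big_split_ord /= lerD//.
by case: J J0 {IH} => // J _; rewrite big_ord_recl /= addn0 lerDl sumr_ge0.
Qed.

Lemma polar (z : R[i]) : exists2 c, rnorm c <= 1 & c * z = (rnorm z)%:C.
Proof.
(* As [0^-1 = 0], the witness is [0] at [z = 0]; elsewhere it is unimodular. *)
exists (z^*%R * ((rnorm z)^-1)%:C).
  rewrite rnormM rnorm_conj rnorm_real ger0_norm ?invr_ge0 ?rnorm_ge0//.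
  have [->|z0] := eqVneq (rnorm z) 0; first by rewrite mul0r.
  by rewrite divff.
rewrite mulrAC mulC_rnorm -rmorphM /=; congr _%:C.
have [->|z0] := eqVneq (rnorm z) 0; first by rewrite expr0n mul0r.
by rewrite expr2 mulfK.
Qed.

End NonnegSums.

(** * Null sequences obtained from small correlations *)

Section NullSequences.
Variables (R : realType) (H : completeNormedModType R[i]).
Variables (dot : {dot H for @Num.conj R[i]}) (dotE : norm_from_dot dot).
Variables (T : {linear H -> H}) (C : R) (C1 : 1 <= C).
Hypothesis Tpow : forall n u, rnorm (iter n T u) <= C * rnorm u.
Hypothesis noeig : forall (z : R[i]) u, rnorm z = 1 -> z *: T u = u -> u = 0.
Variable x : H.

Let C0 : 0 < C. Proof. exact: lt_le_trans C1. Qed.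
Let X := C * rnorm x.
Let X0 : 0 <= X. Proof. by rewrite mulr_ge0 ?rnorm_ge0 ?(ltW C0). Qed.

(** For [a n = n] the differences within a group are the distances between [j] and [l], the same for
    all groups, so [correlation_null] applies with window [p]. *)
Lemma unif_null_id : unif_null T x id.
Proof.
apply: (vdc dotE C1 Tpow (n0 := 1%N)) => //.
  move=> d d0; exists (Num.trunc d^-1).+1, 0%N => p q _ pq kp.
  rewrite -ler_pdivrMl// (le_trans (y := ((Num.trunc d^-1).+1 * (q - p))%:R))//.
    by rewrite natrM ler_wpM2r// ltW// truncnS_gt.
  by rewrite ler_nat.
move=> d d0; have d20 : 0 < d / 2 by rewrite divr_gt0.
have [N0 hN0] := correlation_null dotE C1 Tpow noeig x d20.
exists N0.+1 => // k; have [M0 hM0] := hN0 N0.+1 (leqnSn _).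
exists M0 => p L M0p _ _; rewrite /pair_corr; set J := N0.+1.
rewrite -[leRHS]mulrC mulr_natl -[X in _ *+ X](card_ord L) -sumr_const.
apply: ler_sum => i _.
rewrite expr2 mulrA [leRHS]mulrC mulr_natl -[X in _ *+ X](card_ord J) -sumr_const.
apply: ler_sum => j _.
under eq_bigr do rewrite /= -addn_maxr -addn_minr subnDl.
rewrite (le_trans (ler_sum_dist (corr_ge0 dot T x p) (ltn_ord j)))//.
have := hM0 p M0p; rewrite -/J -[X in X <= _]/(\sum_(n < J) corr dot T x p n); lra.
Qed.

(** Phases from [polar] turn the sum of moduli into a single window form of a bounded-coefficient
    sum; this is where uniformity over the coefficients is used. *)
Lemma sum_corr_le (b : nat -> nat) (N W : nat) (e : R) :
  (forall c : nat -> R[i], (forall n, rnorm (c n) <= 1) ->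
     rnorm (\sum_(n < N) c n *: iter (b n) T x) <= e) ->
  \sum_(n < N) corr dot T x W (b n) <= W%:R * (C * e * X).
Proof.
move=> h.
have /choice[c cP] n : exists c, rnorm c <= 1 /\
    c * window_form dot T W (iter (b n) T x) x = (corr dot T x W (b n))%:C.
  by have [c] := polar (window_form dot T W (iter (b n) T x) x); exists c.
have E : (\sum_(n < N) corr dot T x W (b n))%:C =
    window_form dot T W (\sum_(n < N) c n *: iter (b n) T x) x.
  by rewrite rmorph_sum window_form_suml; apply: eq_bigr => n _; rewrite (cP n).2.
rewrite (le_trans (ler_norm _))// -rnorm_real E.
rewrite (le_trans (window_form_le dotE Tpow _ _ _))// ler_wpM2l// ler_wpM2r//.
by rewrite ler_wpM2l ?(ltW C0)// h// => n; rewrite (cP n).1.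
Qed.

(** In [pair_corr] the [J] diagonal pairs are negligible against [J ^ 2] for large [J]. For
    [j != l], the sum over the groups runs along a progression and is bounded by the sum over all
    [n < p + L * J], to which [sum_corr_le] applies. *)
Lemma unif_null_of_differences (a : nat -> nat) n0 :
  (forall n m, (n0 <= n)%N -> (n <= m)%N -> (a n <= a m)%N) ->
  (forall n, (n0 <= n)%N -> (0 < a n)%N) ->
  (forall d : R, 0 < d -> exists k P0, forall p q,
    (P0 <= p)%N -> (p <= q)%N -> (k * (q - p) <= p)%N ->
    (a q - a p)%N%:R <= d * (a p)%:R) ->
  (forall j l, j != l -> unif_null T x
    (fun n => maxn (a (n + j)%N) (a (n + l)%N) - minn (a (n + j)%N) (a (n + l)%N))%N) ->
  unif_null T x a.
Proof.
move=> mono pos slow diffs; apply: (vdc dotE C1 Tpow mono pos slow) => d d0.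
pose J := (Num.trunc (2 * X ^+ 2 / d)).+1.
have JR : 0 < J%:R :> R by rewrite ltr0n.
have hJ : 2 * X ^+ 2 <= J%:R * d by rewrite -ler_pdivrMr// ltW// truncnS_gt.
exists J => // k.
have CX : 0 <= C * X by rewrite mulr_ge0// ltW.
(* The factor [k.+1] compensates [p + L * J <= k.+1 * (L * J)]; the added [1] keeps the denominator
   positive when [X = 0]. *)
pose e := d / (2 * (C * X + 1) * k.+1%:R).
have e0 : 0 < e.
  by rewrite divr_gt0// mulr_gt0 ?ltr0n// mulr_gt0//; lra.
have eJ : C * X * k.+1%:R * e <= d / 2.
  rewrite (_ : _ * e = d / 2 * ((C * X) / (C * X + 1))); last first.
    by rewrite /e; field; rewrite nat1r pnatr_eq0 andbT; lra.
  by rewrite -[leRHS]mulr1 ler_wpM2l ?divr_ge0 ?(ltW d0)// ler_pdivrMr; lra.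
pose b j l n := (maxn (a (n + j)%N) (a (n + l)%N) - minn (a (n + j)%N) (a (n + l)%N))%N.
have /choice[P0 hP0] (jl : nat * nat) : exists P0 : nat, jl.1 != jl.2 ->
    forall N, (P0 <= N)%N -> forall c : nat -> R[i], (forall n, rnorm (c n) <= 1) ->
    rnorm (\sum_(n < N) c n *: iter (b jl.1 jl.2 n) T x) <= e / J%:R * N%:R.
  have [->|jl_neq] := eqVneq jl.1 jl.2; first by exists 0%N.
  have eJ0 : 0 < e / J%:R by rewrite divr_gt0.
  by have [P0 hP0] := diffs _ _ jl_neq _ eJ0; exists P0 => _.
exists (\max_(j < J) \max_(l < J) P0 (nat_of_ord j, nat_of_ord l))%N => p L Pp pk Lp.
set W := a p; rewrite /pair_corr -/W.
rewrite exchange_big /=.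
have n0' : 0 <= L%:R * W%:R :> R by rewrite mulr_ge0.
have term (j l : 'I_J) : \sum_(i < L) corr dot T x W (b j l (p + i * J)%N) <=
    (j == l)%:R * (L%:R * W%:R * X ^+ 2) + L%:R * W%:R * (d / 2).
  have [->|jl] := eqVneq j l.
    rewrite mul1r -[leLHS]addr0 lerD ?mulr_ge0 ?(ltW d0)//.
    rewrite -mulrA mulr_natl -[X in _ *+ X](card_ord L) -sumr_const.
    apply: ler_sum => i _; rewrite /b maxnn minnn subnn expr2.
    exact: window_form_le.
  rewrite mul0r add0r.
  rewrite (le_trans (ler_sum_progression p L (F := fun n => corr dot T x W (b j l n)) _ _))//.
    by move=> n; exact: corr_ge0.
  have P0N : (P0 (nat_of_ord j, nat_of_ord l) <= p + L * J)%N.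
    rewrite (leq_trans _ (leq_addr _ _))// (leq_trans _ Pp)//.
    rewrite (leq_trans _ (leq_bigmax j))//.
    exact: (leq_bigmax (F := fun l : 'I_J => P0 (nat_of_ord j, nat_of_ord l))).
  rewrite (le_trans (sum_corr_le W (hP0 (nat_of_ord j, nat_of_ord l) jl _ P0N)))//.
  have NR : (p + L * J)%:R <= k.+1%:R * (L%:R * J%:R) :> R.
    by rewrite -!natrM ler_nat; lia.
  have n1 : 0 <= C * X * (e / J%:R) * W%:R.
    by rewrite mulr_ge0 ?ler0n// mulr_ge0// divr_ge0// ltW.
  have h1 := ler_wpM2l n1 NR; have h2 := ler_wpM2l n0' eJ.
  rewrite [leLHS](_ : _ = C * X * (e / J%:R) * W%:R * (p + L * J)%:R); last by ring.
  rewrite (le_trans h1)// (le_trans _ h2)// le_eqVlt; apply/orP; left; apply/eqP.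
  by field; rewrite gt_eqF.
under eq_bigr do rewrite exchange_big /=.
apply: (@le_trans _ _ (\sum_(j < J) \sum_(l < J)
    ((j == l)%:R * (L%:R * W%:R * X ^+ 2) + L%:R * W%:R * (d / 2)))).
  by apply: ler_sum => j _; apply: ler_sum => l _; exact: term.
under eq_bigr => j _.
  rewrite big_split /= -mulr_suml sumr_const card_ord.
  rewrite (bigD1 j)//= eqxx big1 ?addr0 ?mul1r => [|l lj]; last by rewrite eq_sym (negPf lj).
  over.
rewrite sumr_const card_ord -[leLHS]mulr_natl -[_ *+ J]mulr_natl.
have n2 : 0 <= L%:R * W%:R * J%:R :> R by rewrite mulr_ge0.
have := ler_wpM2l n2 hJ; lra.
Qed.

End NullSequences.

(** * The classes P_m *)

Section RegularGrowth.
Variable R : realType.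
Implicit Types (F : nat -> R -> R) (s t u c : R).

(* [F k] is the [k]-th derivative of [F 0]. *)
Definition regular_growth (m : nat) F t1 c : Prop :=
  [/\ 0 < t1 /\ 1 <= c,
      forall k t, (k < m)%N -> t1 <= t -> is_derive t 1 (F k) (F k.+1 t),
      forall k t, (k <= m)%N -> t1 <= t -> 0 < F k t,
      forall t, t1 <= t -> F m.-1 t <= c * (t * F m t) &
      forall s t, t1 <= t -> t <= s -> F m s <= c * F m t].

Lemma growth_mvt m F t1 c k s t : regular_growth m F t1 c -> (k < m)%N ->
  t1 <= s -> s <= t ->
  exists2 u, s <= u <= t & F k t - F k s = F k.+1 u * (t - s).
Proof.
case=> _ hd _ _ _ km t1s st.
have [||u us E] := @MVT_segment R (F k) (F k.+1) s t st.
- by move=> u; rewrite in_itv /= => /andP[su _]; apply: hd => //; lra.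
- apply: derivable_within_continuous => u; rewrite in_itv /= => /andP[su _].
  have t1u : t1 <= u by lra.
  by case: (hd k u km t1u).
- by exists u => //; rewrite in_itv in us.
Qed.

Lemma growth_le m F t1 c k s t : regular_growth m F t1 c -> (k < m)%N ->
  t1 <= s -> s <= t -> F k s <= F k t.
Proof.
move=> hF km t1s st; have [u /andP[su ut] E] := growth_mvt hF km t1s st.
rewrite -subr_ge0 E mulr_ge0 ?subr_ge0//.
by have [_ _ + _ _] := hF => pos; apply: ltW; apply: pos => //; lra.
Qed.

Lemma growth_tail m F t1 c :
  regular_growth m.+2 F t1 c -> regular_growth m.+1 (fun k => F k.+1) t1 c.
Proof. by case=> h0 hd pos h1 h2; split => // k t km; [exact: hd|exact: pos]. Qed.

(** Converse to the bound on [F m] by [t * F m.+1 t]: on [[t / 2, t]] the mean slope of [F m] is at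
    least [F m.+1 t / c]. *)
Lemma growth_top m F t1 c t : regular_growth m.+1 F t1 c -> 2 * t1 <= t ->
  t * F m.+1 t <= 2 * c * F m t.
Proof.
move=> hF tt; have [[t10 c1] _ pos _ h2] := hF.
have t1t : t1 <= t / 2 by lra.
have tt2 : t / 2 <= t by lra.
have [u /andP[su ut] E] := growth_mvt hF (ltnSn m) t1t tt2.
have h := h2 t u (le_trans t1t su) ut.
have p0 := pos m (t / 2) (leqnSn m) t1t.
have : F m.+1 u * (t / 2) <= F m t by rewrite (_ : t / 2 = t - t / 2); lra.
have t0 : 0 <= t by lra.
have c0 : 0 <= 2 * c by lra.
have := ler_wpM2l t0 h; move=> h1 h3; have := ler_wpM2l c0 h3; lra.
Qed.

(** The base case uses [growth_top]. Otherwise [F 1] is doubling by induction, so the increment of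
    [F 0] on [[t, 2 t]] is at most [2 D ^ 2] times that on [[t / 2, t]]. *)
Lemma growth_doubling m F t1 c : regular_growth m.+1 F t1 c ->
  exists D t', [/\ 1 <= D, t1 <= t' & forall t, t' <= t -> F 0%N (2 * t) <= D * F 0%N t].
Proof.
elim: m F t1 c => [|m IH] F t1 c hF; have [[t10 c1] _ pos _ h2] := hF.
  exists (1 + 2 * c ^+ 2), (2 * t1); split; [have := sqr_ge0 c; lra|lra|].
  move=> t tt; have t1t : t1 <= t by lra.
  have tt2 : t <= 2 * t by lra.
  have [u /andP[su ut] E] := growth_mvt hF (ltnSn 0) t1t tt2.
  have h := growth_top hF tt; have hu := h2 u t t1t su.
  have t0 : 0 <= t by lra.
  have c0 : 0 <= c by lra.
  have := ler_wpM2l t0 hu; have := ler_wpM2l c0 h.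
  move=> h3 h4; rewrite -(subrK (F 0%N t) (F 0%N (2 * t))) E; lra.
have [D [t' [D1 t1t' hD]]] := IH _ _ _ (growth_tail hF).
exists (1 + 2 * D ^+ 2), (2 * t'); split; [have := sqr_ge0 D; lra|lra|].
move=> t tt; have t2 : t1 <= t / 2 by lra.
have t1t : t1 <= t by lra.
have tt2 : t <= 2 * t by lra.
have t2t : t / 2 <= t by lra.
have [u /andP[su ut] E] := growth_mvt hF (ltn0Sn _) t1t tt2.
have [v /andP[sv vt] E'] := growth_mvt hF (ltn0Sn _) t2 t2t.
have hv := growth_le hF (isT : (1 < m.+2)%N) t2 sv.
have hu := growth_le hF (isT : (1 < m.+2)%N) (le_trans t1t su) ut.
have h1 : F 1%N (2 * t) <= D * F 1%N t by apply: hD; lra.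
have h3 : F 1%N t <= D * F 1%N (t / 2).
  by rewrite -[in X in X <= _](_ : 2 * (t / 2) = t) ?hD//; lra.
have D0 : 0 <= D by lra.
have t0 : 0 <= t by lra.
have p0 := pos 0%N (t / 2) (leq0n _) t2.
have h4 : F 1%N u <= D ^+ 2 * F 1%N v.
  have := ler_wpM2l D0 h3; have := ler_wpM2l (sqr_ge0 D) hv; lra.
have h5 : F 1%N v * (t / 2) <= F 0%N t by rewrite (_ : t / 2 = t - t / 2); lra.
have := ler_wpM2l t0 h4; have := ler_wpM2l (sqr_ge0 D) h5 => h6 h7.
rewrite -(subrK (F 0%N t) (F 0%N (2 * t))) E; lra.
Qed.

(** If [F 1] is nondecreasing, [F 0] grows at least linearly. At the lowest level,
    [F 0 u <= c u F 1 u] forces every doubling of the argument to add at least [d], so the growth is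
    at least logarithmic. *)
Lemma growth_unbounded m F t1 c (B : R) : regular_growth m.+1 F t1 c ->
  exists2 t', t1 <= t' & forall t, t' <= t -> B <= F 0%N t.
Proof.
move=> hF; suff [t' t1t' Bt'] : exists2 t', t1 <= t' & B <= F 0%N t'.
  exists t' => // t tt; exact: le_trans Bt' (growth_le hF (ltn0Sn _) t1t' tt).
have [[t10 c1] _ pos h1 _] := hF.
case: m hF pos h1 => [|m] hF pos h1; last first.
  have p1 := pos 1%N t1 isT (lexx _); have p0 := pos 0%N t1 isT (lexx _).
  pose t := t1 + `|B| / F 1%N t1.
  have t1t : t1 <= t by rewrite /t lerDl divr_ge0// ltW.
  exists t => //.
  have [v /andP[sv vt] E'] := growth_mvt hF (ltn0Sn _) (lexx _) t1t.
  have hv := growth_le hF (isT : (1 < m.+2)%N) (lexx _) sv.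
  have tt0 : 0 <= t - t1 by lra.
  have := ler_wpM2r tt0 hv; rewrite -E' {1}/t addrC addKr mulrC divfK ?gt_eqF//.
  by have := ler_norm B; lra.
have p0 := pos 0%N t1 isT (lexx _).
pose d := F 0%N t1 / (2 * c).
have d0 : 0 < d by rewrite divr_gt0// mulr_gt0//; lra.
have step t : t1 <= t -> F 0%N t + d <= F 0%N (2 * t).
  move=> t1t; have tt2 : t <= 2 * t by lra.
  have [u /andP[su ut] E] := growth_mvt hF (ltnSn 0) t1t tt2.
  have t1u := le_trans t1t su.
  have hu := h1 u t1u; have h0 := growth_le hF (ltnSn 0) (lexx _) t1u.
  have pu := pos 1%N u isT t1u.
  have c0 : 0 <= c * F 1%N u by rewrite mulr_ge0// ?ltW//; lra.
  have h3 := ler_wpM2l c0 ut.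
  suff : d <= F 1%N u * t by lra.
  rewrite /d ler_pdivrMr; last by lra.
  move: hu h0 h3 => /=; lra.
have grow n : F 0%N t1 + n%:R * d <= F 0%N (2 ^+ n * t1).
  elim: n => [|n IH]; first by rewrite expr0 mul0r addr0 mul1r.
  have tn : t1 <= 2 ^+ n * t1 by rewrite ler_peMl ?(ltW t10)// exprn_ege1// ler1n.
  have := step _ tn; rewrite exprS -mulrA -natr1; lra.
exists (2 ^+ (Num.trunc (`|B| / d)).+1 * t1).
  by rewrite ler_peMl ?(ltW t10)// exprn_ege1// ler1n.
apply: le_trans (grow _).
have : `|B| / d <= (Num.trunc (`|B| / d)).+1%:R by rewrite ltW// truncnS_gt.
by rewrite ler_pdivrMr//; have := ler_norm B; lra.
Qed.

(** Up to [u] the slope never falls below [F 1 u / c], which limits the length of an interval where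
    [F 0] gains at most [B]. *)
Lemma growth_gap F t1 c B s t u : regular_growth 1 F t1 c ->
  t1 <= s -> s <= t -> t <= u -> F 0%N t - F 0%N s <= B ->
  (t - s) * F 1%N u <= B * c.
Proof.
move=> hF t1s st tu; have [v /andP[sv vt] ->] := growth_mvt hF (ltnSn 0) t1s st.
have [[t10 c1] _ _ _ h2] := hF => hB.
have hv : F 1%N u <= c * F 1%N v by apply: h2; lra.
have ts : 0 <= t - s by lra.
have c0 : 0 <= c by lra.
have := ler_wpM2l ts hv; have := ler_wpM2l c0 hB; lra.
Qed.

(** [F 1] is nondecreasing, so the increment of [F 0] on [[2 p, 4 p]] and two doublings give
    [2 p F 1 (2 p) <= D ^ 2 F 0 p]; on [[p, q]] the slope is at most [F 1 (2 p)]. *)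
Lemma growth_slow m F t1 c (d : R) : regular_growth m.+2 F t1 c -> 0 < d ->
  exists (k : nat) t', t1 <= t' /\ forall p q : R, t' <= p -> p <= q ->
    k.+1%:R * (q - p) <= p -> F 0%N q - F 0%N p <= d * F 0%N p.
Proof.
move=> hF d0; have [[t10 c1] _ pos _ _] := hF.
have [D [t2 [D1 t12 hD]]] := growth_doubling hF.
pose k := Num.trunc (D ^+ 2 / d).
have kd : D ^+ 2 <= k.+1%:R * d by rewrite -ler_pdivrMr// ltW// truncnS_gt.
exists k, t2; split=> // p q t2p pq kqp; have t1p := le_trans t12 t2p.
have k1 : 1 <= k.+1%:R :> R by rewrite ler1n.
have k0 : 0 < k.+1%:R :> R by rewrite ltr0n.
have qp0 : 0 <= q - p by lra.
have q2p : q <= 2 * p by have := ler_wpM2r qp0 k1; lra.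
have [u /andP[pu uq] ->] := growth_mvt hF (ltn0Sn _) t1p pq.
have p0 : 0 < p by lra.
have t12p : t1 <= 2 * p by lra.
have p24 : 2 * p <= 2 * (2 * p) by lra.
have [v /andP[pv _] Ev] := growth_mvt hF (ltn0Sn _) t12p p24.
have up := growth_le hF (isT : (1 < m.+2)%N) (le_trans t1p pu) (le_trans uq q2p).
have pv' := growth_le hF (isT : (1 < m.+2)%N) t12p pv.
have F2 := pos 0%N _ (leq0n _) t12p; have Fp := pos 0%N _ (leq0n _) t1p.
have F12 := pos 1%N _ isT t12p.
have D2 : F 0%N (2 * (2 * p)) <= D * F 0%N (2 * p) by apply: hD; lra.
have D3 : F 0%N (2 * p) <= D * F 0%N p by exact: hD.
have D0 : 0 <= D by lra.
have p20 : 0 <= 2 * p by lra.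
have s1 : F 1%N (2 * p) * (2 * p) <= D ^+ 2 * F 0%N p.
  have := ler_wpM2l p20 pv'; have := ler_wpM2l D0 D3; rewrite expr2; lra.
have s2 := ler_wpM2l (ltW F12) kqp; have s3 := ler_wpM2r (ltW Fp) kd.
rewrite (le_trans (ler_wpM2r qp0 up))// -(ler_pM2l k0).
have : 0 <= D ^+ 2 * F 0%N p by rewrite mulr_ge0 ?exprn_ge0 ?(ltW Fp).
lra.
Qed.

(** By the mean value theorem each difference is [s2 - s1] times a nearby value of [F k.+1], so the
    estimates for [F] carry over one level down. *)
Lemma growth_difference m F t1 c s1 s2 : regular_growth m.+2 F t1 c ->
  0 <= s1 -> s1 < s2 ->
  exists t' c', regular_growth m.+1 (fun k t => F k (t + s2) - F k (t + s1)) t' c'.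
Proof.
move=> hF s10 s12; have [[t10 c1] hd pos h1 h2] := hF.
have c0 : 0 <= c by lra.
have mvt k t : (k < m.+2)%N -> t1 <= t -> exists2 u, t + s1 <= u <= t + s2 &
    F k (t + s2) - F k (t + s1) = F k.+1 u * (s2 - s1).
  move=> km t1t; have t1s : t1 <= t + s1 by lra.
  have st : t + s1 <= t + s2 by lra.
  have [u us E] := growth_mvt hF km t1s st.
  by exists u => //; rewrite E; congr (_ * _); lra.
(* Beyond this point [t + s2 <= 2 * t], and [2 * t1 <= t] as [growth_top] requires. *)
exists (2 * t1 + s2), (4 * c ^+ 4); split.
- split; first by lra.
  by rewrite -[leLHS](mulr1 1) ler_pM// ?ler1n// exprn_ege1.
- move=> k t km tt; have hd' (s : R) : 0 <= s ->
      is_derive t 1 (fun t => F k (t + s)) (F k.+1 (t + s)).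
    move=> s0; rewrite -[X in is_derive _ _ _ X]mulr1.
    apply: (@is_derive1_comp _ (F k) (shift s)).
      have h : is_derive (t + s) 1 (F k) (F k.+1 (t + s)) by apply: hd; [lia|lra].
      exact: h.
    exact: is_derive_shift.
  have s20 : 0 <= s2 by lra.
  exact: (is_deriveB (hd' s2 s20) (hd' s1 s10)).
- move=> k t km tt; have t1t : t1 <= t by lra.
  have [u /andP[su ut] ->] := mvt k t km t1t.
  by rewrite mulr_gt0 ?subr_gt0// pos//; lra.
- move=> t tt /=; have t1t : t1 <= t by lra.
  have [u /andP[su ut] ->] := mvt m t (ltnW (ltnSn _)) t1t.
  have [v /andP[sv vt] ->] := mvt m.+1 t (ltnSn _) t1t.
  have a1 : F m.+1 u <= F m.+1 (t + s2) by apply: (growth_le hF) => //; lra.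
  have a2 : F m.+1 (t + s2) <= c * ((t + s2) * F m.+2 (t + s2)) by apply: h1; lra.
  have a3 : F m.+2 (t + s2) <= c * F m.+2 v by apply: h2; lra.
  have pv : 0 < F m.+2 v by apply: pos => //; lra.
  have b0 : 0 <= c * (t + s2) by rewrite mulr_ge0//; lra.
  have := ler_wpM2l b0 a3 => a4.
  have cc : c * (t + s2) * c <= 4 * c ^+ 4 * t.
    have : c ^+ 2 <= c ^+ 4 by rewrite ler_weXn2l.
    have q0 : 0 <= c ^+ 2 by rewrite exprn_ge0.
    have t0 : 0 <= t by lra.
    move=> q1; have := ler_wpM2l t0 q1; have : c ^+ 2 * s2 <= c ^+ 2 * t.
      by rewrite ler_wpM2l//; lra.
    have : 0 <= c ^+ 2 * t by rewrite mulr_ge0.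
    rewrite expr2; lra.
  have := ler_wpM2r (ltW pv) cc => a5.
  have d0 : 0 <= s2 - s1 by lra.
  have a6 : F m.+1 u <= 4 * c ^+ 4 * t * F m.+2 v by lra.
  have := ler_wpM2r d0 a6; lra.
(* The intermediate points [u] and [v] may come in either order. So [F m.+2 u] is compared with
   [F m.+2 t], then through [F m.+1] with [F m.+2 (t + s2)], and finally with [F m.+2 v]. *)
- move=> s t tt ts; have t1t : t1 <= t by lra.
  have t1s : t1 <= s by lra.
  have [u /andP[su ut] ->] := mvt m.+1 s (ltnSn _) t1s.
  have [v /andP[sv vt] ->] := mvt m.+1 t (ltnSn _) t1t.
  have t0 : 0 < t by lra.
  have d0 : 0 <= s2 - s1 by lra.
  have a1 : F m.+2 u <= c * F m.+2 t by apply: h2; lra.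
  have a2 : t * F m.+2 t <= 2 * c * F m.+1 t by apply: (growth_top hF); lra.
  have a3 : F m.+1 t <= F m.+1 (t + s2) by apply: (growth_le hF) => //; lra.
  have a4 : F m.+1 (t + s2) <= c * ((t + s2) * F m.+2 (t + s2)) by apply: h1; lra.
  have a5 : F m.+2 (t + s2) <= c * F m.+2 v by apply: h2; lra.
  have pv : 0 < F m.+2 v by apply: pos => //; lra.
  have b1 : (t + s2) * F m.+2 (t + s2) <= (2 * t) * (c * F m.+2 v).
    by apply: ler_pM => //; [lra|apply: ltW; apply: pos => //; lra|lra].
  have b2 : F m.+1 t <= 2 * t * c ^+ 2 * F m.+2 v.
    have := ler_wpM2l c0 b1; rewrite expr2; lra.
  have b3 : t * F m.+2 t <= t * (4 * c ^+ 3 * F m.+2 v).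
    have c20 : 0 <= 2 * c by lra.
    have := ler_wpM2l c20 b2; rewrite !exprS expr0; lra.
  rewrite ler_pM2l// in b3.
  have := ler_wpM2l c0 b3 => b4.
  have b5 : F m.+2 u <= 4 * c ^+ 4 * F m.+2 v by rewrite exprS; lra.
  have := ler_wpM2r d0 b5; lra.
Qed.

(** A [limf_esup] below [+oo] provides a half-line with a uniform bound; the sum of the two bounds
    serves as the common constant. *)
Lemma class_P_growth m t0 (f : R -> R) : (1 <= m)%N -> class_P m t0 f ->
  exists t1 c, [/\ regular_growth m (fun k => derive1n k f) t1 c & t0 <= t1].
Proof.
move=> m1 [_ [M1 [_ hM1]] /ereal_inf_lt[_ [V2 [M2 [_ hM2]] <-] lt2]
  /ereal_inf_lt[_ [V3 [M3 [_ hM3]] <-] lt3]].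
have bnd (S : set \bar R) : (ereal_sup S < +oo)%E ->
    exists2 c : R, 1 <= c & forall r : R, S r%:E -> r <= c.
  move=> Sfin; case E : (ereal_sup S) Sfin => [r| |]// _.
    exists (Num.max 1 r); first by rewrite le_max lexx.
    by move=> r' /ereal_sup_ubound; rewrite E lee_fin => h; rewrite le_max h orbT.
  by exists 1 => // r' /ereal_sup_ubound; rewrite E.
have [c2 c21 hc2] := bnd _ lt2.
have [c3 c31 hc3] : exists2 c, 1 <= c & forall s t, M3 < t -> t <= s ->
    (derive1n m f s / derive1n m f t) <= c.
  move: lt3; set S := (_ @` _).
  case E : (ereal_sup S) => [r| |]// _; last first.
    exists 1 => // s t M3t ts; exfalso.
    have /ereal_sup_ubound : S (ereal_sup [set (derive1n m f s / derive1n m f t)%:E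
        | s in [set s : R | t <= s]]) by exists t => //; exact: hM3.
    rewrite E leeNy_eq => /eqP E'.
    have : [set (derive1n m f s / derive1n m f t)%:E
        | s in [set s : R | t <= s]] (derive1n m f s / derive1n m f t)%:E by exists s.
    by move/ereal_sup_ubound; rewrite E'.
  exists (Num.max 1 r); first by rewrite le_max lexx.
  move=> s t M3t ts.
  have /ereal_sup_ubound : S (ereal_sup [set (derive1n m f s / derive1n m f t)%:E
      | s in [set s : R | t <= s]]) by exists t => //; exact: hM3.
  rewrite E => h.
  have : [set (derive1n m f s / derive1n m f t)%:E
      | s in [set s : R | t <= s]] (derive1n m f s / derive1n m f t)%:E by exists s.
  move/ereal_sup_ubound/le_trans/(_ h); rewrite lee_fin => h'.
  by rewrite le_max h' orbT.
pose t1 := `|M1| + `|M2| + `|M3| + `|t0| + 1.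
have tM t : t1 <= t -> [/\ M1 < t, M2 < t, M3 < t & t0 <= t].
  rewrite /t1 => tt.
  have := ler_norm M1; have := ler_norm M2; have := ler_norm M3; have := ler_norm t0.
  have := normr_ge0 M1; have := normr_ge0 M2; have := normr_ge0 M3; have := normr_ge0 t0.
  by split; lra.
have t10 : 0 < t1.
  have := normr_ge0 M1; have := normr_ge0 M2; have := normr_ge0 M3; have := normr_ge0 t0.
  by rewrite /t1; lra.
exists t1, (c2 + c3); split; last by case: (tM t1 (lexx _)).
have pos k t : (k <= m)%N -> t1 <= t -> 0 < derive1n k f t.
  by move=> km /tM[/hM1[_ +] _ _ _] => /(_ k km)[].
split => //.
- by split=> //; lra.
- move=> k t km /tM[/hM1[+ _] _ _ _] => /(_ k km) /derivableP.
  by rewrite -derive1E -derive1nS.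
- move=> t tt; have pt := pos m t (leqnn _) tt.
  have [_ M2t _ _] := tM t tt.
  have t0' : 0 < t by lra.
  have /hc2 : [set (derive1n m.-1 f t / (t * derive1n m f t))%:E | t in V2]
    (derive1n m.-1 f t / (t * derive1n m f t))%:E by exists t => //; exact: hM2.
  rewrite ler_pdivrMr ?mulr_gt0// => h; rewrite (le_trans h)// ler_wpM2r//; last by lra.
  by rewrite mulr_ge0// ltW.
- move=> s t tt ts; have pt := pos m t (leqnn _) tt.
  have [_ _ M3t _] := tM t tt.
  have := hc3 s t M3t ts; rewrite ler_pdivrMr// => h; rewrite (le_trans h)//.
  by rewrite ler_wpM2r ?(ltW pt)//; lra.
Qed.

End RegularGrowth.

(** * Exponents close to a function of class P_m *)

Lemma count_short_range (P : pred nat) (B N : nat) :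
  (forall n k, P n -> P k -> (n <= k)%N -> (k < N)%N -> (k - n <= B)%N) ->
  (\sum_(n < N) P n <= B.+1)%N.
Proof.
move=> hP; have [[n0 Pn0]|noP] := pselect (exists n, P n); last first.
  rewrite big1// => n _; apply/eqP; rewrite eqb0.
  by apply/negP => Pn; apply: noP; exists n.
have exP : exists n, P n by exists n0.
case: (ex_minnP exP) => k Pk k_min.
rewrite -(big_mkord xpredT (fun n => nat_of_bool (P n))).
rewrite (eq_bigr (fun n => if P n then 1 else 0))%N; last by move=> n _; case: (P n).
rewrite -big_mkcond sum1_count -size_filter -[leqRHS](size_iota k B.+1).
apply: uniq_leq_size; first by rewrite filter_uniq// iota_uniq.
move=> n; rewrite mem_filter !mem_iota subn0 => /and3P[Pn _ nN].
by have := hP _ _ Pk Pn (k_min n Pn) nN; have := k_min n Pn; lia.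
Qed.

Section GrowthNull.
Variables (R : realType) (H : completeNormedModType R[i]).
Variables (dot : {dot H for @Num.conj R[i]}) (dotE : norm_from_dot dot).
Variables (T : {linear H -> H}) (C : R) (C1 : 1 <= C).
Hypothesis Tpow : forall n u, rnorm (iter n T u) <= C * rnorm u.
Hypothesis noeig : forall (z : R[i]) u, rnorm z = 1 -> z *: T u = u -> u = 0.
Variable x : H.

Let C0 : 0 < C. Proof. exact: lt_le_trans C1. Qed.
Let X := C * rnorm x.
Let X0 : 0 <= X. Proof. by rewrite mulr_ge0 ?rnorm_ge0 ?(ltW C0). Qed.

(* Each value is taken by [a] at most [Q = O (n / F 0 n)] times before [n], so
   the sum over [a] is [Q] times a bounded-coefficient sum of [F 0 n + O (1)]
   consecutive powers. *)
Lemma unif_null_growth1 F t1 c (a : nat -> nat) (M : R) n0 :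
  regular_growth 1 F t1 c ->
  (forall n, (n0 <= n)%N -> `|(a n)%:R - F 0%N n%:R| <= M) ->
  unif_null T x a.
Proof.
move=> hF aF eps eps0; have [[t10 c1] hd pos h1 h2] := hF.
have M0 : 0 <= M by apply: le_trans (aF n0 (leqnn _)); exact: normr_ge0.
have p1 := pos 1%N t1 isT (lexx _).
(* Chosen so that [B.+1 * K <= A * N]: multiply [K <= 2 * FN <= 2 * c * N * G] by [B.+1] and use
   [BG]. *)
pose A := 2 * c * (c * F 1%N t1 + 2 * M * c).
have A0 : 0 < A.
  have h : 0 < c * F 1%N t1 by rewrite mulr_gt0//; lra.
  have h' : 0 <= 2 * M * c by rewrite !mulr_ge0//; lra.
  by rewrite /A mulr_gt0//; lra.
have e0 : 0 < eps / 2 / A by rewrite !divr_gt0.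
have [K0 hK0] := unif_null_id dotE C1 Tpow noeig x e0.
have [t2 t12 hB] := growth_unbounded (K0%:R + M + 1) hF.
pose n1 := maxn n0 (Num.trunc t2).+1.
have n1t n : (n1 <= n)%N -> t1 <= n%:R :> R /\ t2 <= n%:R :> R.
  move=> n1n; have : t2 <= n%:R.
    rewrite (le_trans (ltW (truncnS_gt _)))// ler_nat (leq_trans _ n1n)//.
    exact: leq_maxr.
  by move=> h; split=> //; lra.
have [n2 hn2] : exists n2 : nat, n1%:R * X / (eps / 2) <= n2%:R.
  by exists (Num.trunc (n1%:R * X / (eps / 2))).+1; rewrite ltW// truncnS_gt.
exists (maxn n1.+1 n2) => N; rewrite geq_max => /andP[n1N n2N] d d1.
have [t1N t2N] := n1t N (ltnW n1N).
set FN := F 0%N N%:R.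
have FNB : K0%:R + M + 1 <= FN by exact: hB.
have N0 : 0 < N%:R :> R by lra.
set G := F 1%N N%:R.
have G0 : 0 < G by apply: pos.
(* Indices with equal [a] have values of [F 0] within [2 * M], so by [growth_gap] they are at most
   [2 * M * c / G] apart. *)
pose B := Num.trunc (2 * M * c / G).
have BG : B.+1%:R * G <= c * F 1%N t1 + 2 * M * c.
  have hc : 0 <= 2 * M * c by rewrite !mulr_ge0//; lra.
  have hG : G <= c * F 1%N t1 by apply: h2.
  have : B%:R <= 2 * M * c / G by rewrite truncn_le divr_ge0// ltW.
  rewrite ler_pdivlMr// -natr1; lra.
pose K := (Num.trunc (FN + M)).+1.
have Kle : K%:R <= 2 * FN.
  have : (Num.trunc (FN + M))%:R <= FN + M by rewrite truncn_le; have := ler0n R K0; lra.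
  rewrite /K -natr1; have := ler0n R K0; lra.
have KK0 : (K0 <= K)%N.
  rewrite -(ler_nat R); have := truncnS_gt (FN + M); rewrite -/K; lra.
have aK n : (n1 <= n)%N -> (n < N)%N -> (a n < K)%N.
  move=> n1n nN; have [t1n _] := n1t n n1n.
  have := aF n (leq_trans (leq_maxl _ _) n1n); rewrite ler_norml => /andP[_ h].
  have hFn : F 0%N n%:R <= FN by apply: (growth_le hF) => //; rewrite ler_nat ltnW.
  rewrite -(ltr_nat R); have := truncnS_gt (FN + M); rewrite -/K; lra.
pose N' := (N - n1)%N.
have NE : N = (n1 + N')%N by rewrite subnKC// ltnW.
pose co k := \sum_(n < N') if a (n1 + n)%N == k then d (n1 + n)%N else 0.
have SE : \sum_(n < N) d n *: iter (a n) T x = \sum_(n < n1) d n *: iter (a n) T x +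
    \sum_(k < K) co k *: iter k T x.
  rewrite [in LHS]NE big_split_ord /=; congr (_ + _).
  rewrite /co; under [RHS]eq_bigr do rewrite scaler_suml.
  rewrite exchange_big /=; apply: eq_bigr => n _.
  have nN : (n1 + n < N)%N by rewrite NE ltn_add2l.
  rewrite (bigD1 (Ordinal (aK _ (leq_addr n n1) nN))) //= eqxx big1 ?addr0// => k kn.
  case: eqP => [E|]; last by rewrite scale0r.
  by case/negP: kn; apply/eqP/val_inj; rewrite /= E.
have coB k : rnorm (co k) <= B.+1%:R.
  rewrite (le_trans (rnorm_sum _ _ _))//.
  apply: (@le_trans _ _ (\sum_(n < N') (a (n1 + n)%N == k)%:R)).
    by apply: ler_sum => n _; case: eqP; rewrite ?rnorm0 ?d1.
  rewrite -(natr_sum _ _ _ (fun n : 'I_N' => nat_of_bool (a (n1 + n)%N == k))) ler_nat.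
  apply: (@count_short_range (fun n => a (n1 + n)%N == k)) => n l /eqP an /eqP al nl lN.
  have n1n := leq_addr n n1; have n1l := leq_addr l n1.
  have [t1n _] := n1t _ n1n; have [t1l _] := n1t _ n1l.
  have := aF _ (leq_trans (leq_maxl _ _) n1n); have := aF _ (leq_trans (leq_maxl _ _) n1l).
  rewrite an al !ler_norml => /andP[q1 q2] /andP[q3 q4].
  have nl' : (n1 + n)%:R <= (n1 + l)%:R :> R by rewrite ler_nat leq_add2l.
  have lN' : (n1 + l)%:R <= N%:R :> R by rewrite ler_nat NE leq_add2l ltnW.
  have gap : F 0%N (n1 + l)%:R - F 0%N (n1 + n)%:R <= 2 * M.
    by move: q1 q2 q3 q4; lra.
  have := growth_gap hF t1n nl' lN' gap.
  rewrite -natrB ?leq_add2l// subnDl -ler_pdivlMr// => lnB.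
  by rewrite -ltnS -(ltr_nat R) (le_lt_trans lnB)// truncnS_gt.
have part2 : rnorm (\sum_(k < K) co k *: iter k T x) <= eps / 2 * N%:R.
  have B0 : 0 < B.+1%:R :> R by rewrite ltr0n.
  have -> : \sum_(k < K) co k *: iter k T x =
      (B.+1%:R : R)%:C *: \sum_(k < K) ((B.+1%:R^-1 : R)%:C * co k) *: iter k T x.
    rewrite scaler_sumr; apply: eq_bigr => k _.
    by rewrite scalerA mulrA -rmorphM /= divff ?gt_eqF// rmorph1 mul1r.
  rewrite rnormZ rnorm_real ger0_norm ?(ltW B0)//.
  have co1 k : rnorm ((B.+1%:R^-1 : R)%:C * co k) <= 1.
    by rewrite rnormM rnorm_real ger0_norm ?invr_ge0// ler_pdivrMl// mulr1.
  have := ler_wpM2l (ltW B0) (hK0 K KK0 _ co1) => /le_trans; apply.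
  have hFN : FN <= c * (N%:R * G) by exact: h1.
  have cN : 0 <= 2 * (c * N%:R) by rewrite !mulr_ge0//; lra.
  have w1 := ler_wpM2l cN BG.
  have w2 : B.+1%:R * K%:R <= A * N%:R.
    have b1 := ler_wpM2l (ltW B0) Kle; have b2 := ler_wpM2l (ltW B0) hFN.
    rewrite /A; lra.
  have w3 := ler_wpM2l (ltW e0) w2.
  rewrite (_ : eps / 2 * N%:R = eps / 2 / A * (A * N%:R)); first lra.
  by field; rewrite gt_eqF.
rewrite SE (le_trans (rnormD _ _))// (_ : eps * _ = N%:R * (eps / 2) + eps / 2 * N%:R); last first.
  by field.
rewrite lerD// (le_trans (sum_scale_le Tpow _ _ _ d1))// -ler_pdivrMr ?divr_gt0//.
by rewrite (le_trans hn2)// ler_nat.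
Qed.

(** Induction on [m]: the differences of shifts of [a] stay within [2 * M] of those of [F 0], which
    lie one class lower by [growth_difference]. *)
Lemma unif_null_growth m F t1 c (a : nat -> nat) (M : R) n0 :
  regular_growth m.+1 F t1 c ->
  (forall n, (n0 <= n)%N -> `|(a n)%:R - F 0%N n%:R| <= M) ->
  unif_null T x a.
Proof.
elim: m F t1 c a M n0 => [|m IH] F t1 c a M n0 hF aF.
  exact: unif_null_growth1 hF aF.
have [[t10 c1] hd pos h1 h2] := hF.
have M0 : 0 <= M by apply: le_trans (aF n0 (leqnn _)); exact: normr_ge0.
(* Once the slope [F 1] is at least [2 * M], a unit step of [F 0] outweighs the two errors [M], so
   [a] is nondecreasing. *)
have [t3 t13 hB1] := growth_unbounded (2 * M) (growth_tail hF).
have [t4 t14 hB0] := growth_unbounded (M + 1) hF.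
pose n1 := maxn n0 (Num.trunc (t3 + t4)).+1.
have n1t n : (n1 <= n)%N -> t3 <= n%:R /\ t4 <= n%:R :> R.
  move=> n1n; have : t3 + t4 <= n%:R.
    rewrite (le_trans (ltW (truncnS_gt _)))// ler_nat (leq_trans _ n1n)//.
    exact: leq_maxr.
  by move=> h; split=> //; lra.
have aF' n : (n1 <= n)%N -> F 0%N n%:R - M <= (a n)%:R /\ (a n)%:R <= F 0%N n%:R + M.
  move=> n1n; have := aF n (leq_trans (leq_maxl _ _) n1n).
  by rewrite ler_norml => /andP[]; split; lra.
have mono n k : (n1 <= n)%N -> (n <= k)%N -> (a n <= a k)%N.
  move=> n1n; rewrite leq_eqVlt => /predU1P[<-//|nk].
  have n1k := leq_trans n1n (ltnW nk).
  have [t3n _] := n1t n n1n; have t1n := le_trans t13 t3n.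
  have nk' : n%:R <= k%:R :> R by rewrite ler_nat ltnW.
  have [u /andP[su _] E] := growth_mvt hF (ltn0Sn _) t1n nk'.
  have hu := hB1 u (le_trans t3n su).
  have kn1 : 1 <= k%:R - n%:R :> R by rewrite -natrB ?(ltnW nk)// ler1n subn_gt0.
  have : 2 * M * 1 <= F 1%N u * (k%:R - n%:R) by apply: ler_pM => //; lra.
  have [_ q1] := aF' n n1n; have [q2 _] := aF' k n1k.
  by rewrite -(ler_nat R); lra.
apply: (unif_null_of_differences dotE C1 Tpow (n0 := n1) mono).
- move=> n n1n; have [_ t4n] := n1t n n1n.
  by have [q _] := aF' n n1n; have := hB0 _ t4n; rewrite -(ltr_nat R); lra.
- move=> d d0; have d20 : 0 < d / 2 by rewrite divr_gt0.
  have [k [t5 [t15 hslow]]] := growth_slow hF d20.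
  (* Here [d / 2 * F 0 p] exceeds the accumulated errors: [2 * M] from [a q - a p] and [d * M] from
     replacing [F 0 p] by [a p]. *)
  have [t6 t16 hB6] := growth_unbounded (2 * (2 * M + d * M) / d) hF.
  exists k.+1, (maxn n1 (Num.trunc (t5 + t6)).+1) => p q.
  rewrite geq_max => /andP[n1p t5p] pq kqp.
  have t56p : t5 + t6 <= p%:R by rewrite (le_trans (ltW (truncnS_gt _)))// ler_nat.
  have t5p' : t5 <= p%:R by move: t56p t16 t10; lra.
  have t6p : t6 <= p%:R by move: t56p t15 t10; lra.
  have := hB6 _ t6p; rewrite ler_pdivrMr// => big.
  have pq' : p%:R <= q%:R :> R by rewrite ler_nat.
  have qpR : k.+1%:R * (q%:R - p%:R) <= p%:R :> R by rewrite -natrB// -natrM ler_nat.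
  have := hslow _ _ t5p' pq' qpR.
  have [_ r1] := aF' q (leq_trans n1p pq); have [r2 _] := aF' p n1p.
  have := ler_wpM2l (ltW d0) r2.
  by rewrite natrB ?mono//; move: big r1 r2; lra.
have key i j : (i < j)%N -> unif_null T x
    (fun n => (maxn (a (n + i)%N) (a (n + j)%N) - minn (a (n + i)%N) (a (n + j)%N))%N).
  move=> ij; have ijR : i%:R < j%:R :> R by rewrite ltr_nat.
  have [t' [c' hG]] := growth_difference hF (ler0n R i) ijR.
  apply: (IH _ _ _ _ (2 * M) n1 hG) => n n1n.
  have n1i : (n1 <= n + i)%N by lia.
  have n1j : (n1 <= n + j)%N by lia.
  have le_ij : (a (n + i) <= a (n + j))%N by apply: mono => //; lia.
  rewrite (maxn_idPr le_ij) (minn_idPl le_ij) natrB// -!natrD ler_norml.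
  have [r1 r2] := aF' _ n1i; have [r3 r4] := aF' _ n1j.
  by apply/andP; split; lra.
move=> i j ij; case: (ltngtP i j) ij => // ij _; first exact: key.
have -> : (fun n => (maxn (a (n + i)%N) (a (n + j)%N) - minn (a (n + i)%N) (a (n + j)%N))%N) =
    (fun n => (maxn (a (n + j)%N) (a (n + i)%N) - minn (a (n + j)%N) (a (n + i)%N))%N).
  by apply/funext => n; rewrite maxnC minnC.
exact: key.
Qed.

End GrowthNull.

(** * From the hypotheses on [T] and [A] to the averages along [A] *)

Section FinalHypotheses.
Variables (R : realType) (H : normedModType R[i]) (T : {linear H -> H}).

Lemma power_bounded_rnorm : power_bounded T ->
  exists2 C : R, 1 <= C & forall n u, rnorm (iter n T u) <= C * rnorm u.
Proof.
rewrite /power_bounded => pb.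
have [C C1 hC] : exists2 C : R, 1 <= C & forall n u, `|u| <= 1 -> rnorm (iter n T u) <= C.
  have sup_le n u : `|u| <= 1 ->
      ((rnorm (iter n T u))%:E <= ereal_sup (range (fun n => op_norm (iter n T))))%E.
    move=> u1; apply: le_trans (ereal_sup_ubound _); last by exists n.
    by apply: ereal_sup_ubound; exists u.
  case E : (ereal_sup _) pb sup_le => [r| |]// _ sup_le.
    exists (Num.max 1 r); first by rewrite le_max lexx.
    by move=> n u /(sup_le n); rewrite lee_fin => h; rewrite le_max h orbT.
  by exists 1 => // n u /(sup_le n).
exists C => // n u.
have [->|u0] := eqVneq u 0; first by rewrite iter_lin0 rnorm0 mulr0.
have nu : 0 < rnorm u.
  by rewrite lt_neqAle rnorm_ge0 andbT eq_sym; apply: contra_neq u0 => /rnorm_eq0.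
pose v := ((rnorm u)^-1)%:C *: u.
have nv : rnorm v = 1 by rewrite rnormZ rnorm_real gtr0_norm ?invr_gt0// mulVf ?gt_eqF.
have uE : u = (rnorm u)%:C *: v.
  by rewrite scalerA -rmorphM /= divff ?gt_eqF// rmorph1 scale1r.
rewrite [X in iter n T X]uE iter_linZ rnormZ rnorm_real ger0_norm ?(ltW nu)// mulrC.
by rewrite ler_wpM2r ?(ltW nu)// hC// rnormE nv.
Qed.

Lemma no_unimodular_eigenvector : point_spectrum T `&` @unit_circle R = set0 ->
  forall (z : R[i]) u, rnorm z = 1 -> z *: T u = u -> u = 0.
Proof.
move=> sp z u z1 zTu; apply/eqP; apply/negPn/negP => u0.
have z0 : z != 0 by apply/eqP => z0; move: z1; rewrite z0 rnorm0 => /eqP; rewrite eq_sym oner_eq0.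
suff : (point_spectrum T `&` @unit_circle R) z^-1 by rewrite sp.
split; last by rewrite /unit_circle /= normrV ?unitfE// rnormE z1 invr1.
by exists u => //; rewrite -[in RHS]zTu scalerA mulVf// scale1r.
Qed.

End FinalHypotheses.

(** Makes bounds proportional to [N] usable for averages normalized by the cardinality. *)
Lemma positive_density_card (R : realType) (A : set nat) : regular R A ->
  exists2 d : R, 0 < d & exists N0, forall N, (N0 <= N)%N ->
    d * N%:R <= (card_upto A N)%:R.
Proof.
case=> -[d d0 hd] _; exists (d / 2); first by rewrite divr_gt0.
have d20 : 0 < d / 2 by rewrite divr_gt0.
have /cvgrPdist_lt/(_ _ d20)[N0 _ hN0] := hd.
exists N0.+1 => N NN0; have := hN0 N (ltnW NN0); rewrite /= ltr_norml => /andP[_ h].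
have N_gt0 : 0 < N%:R :> R by rewrite ltr0n (leq_trans _ NN0).
rewrite -ler_pdivlMr//; lra.
Qed.

Theorem theorem3p5 (R : realType) (H : completeNormedModType R[i])
    (dot : {dot H for @Num.conj R[i]}) (dotE : norm_from_dot dot)
    (T : {linear H -> H}) (Tcont : continuous T)
    (Tpb : power_bounded T)
    (Tsp : point_spectrum T `&` @unit_circle R = set0)
    (A : set nat) (Areg : regular R A)
    (m : nat) (m_ge1 : (1 <= m)%N)
    (t0 : R) (f : R -> R) (fP : class_P m t0 f)
    (h : nat -> int) (hbd : exists M : int, forall n, `|h n| <= M)
    (x : H) :
  (fun N : nat =>
     (card_upto A N)%:R^-1 *:
       \sum_(1 <= n < N.+1 | n \in A) op_pow T t0 f h n x) @ \oo --> (0 : H).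
Proof.
have [C C1 Tpow] := power_bounded_rnorm Tpb.
have noeig := no_unimodular_eigenvector Tsp.
have [d d0 [N1 hN1]] := positive_density_card Areg.
have [M hM] := hbd.
have [t1 [c [hf t01]]] := class_P_growth m_ge1 fP.
case: m m_ge1 fP hf => // m _ _ hf.
pose e n : int := Num.floor (f n%:R) + h n.
pose a n : nat := if (t0 <= n%:R) && (0 <= e n) then `|e n|%N else 0%N.
have op_powE n : op_pow T t0 f h n x = iter (a n) T x.
  by rewrite /op_pow /a -/(e n); case: ifP.
(* From [t2] on [f n >= M + 1], so the exponent is nonnegative and the identity convention does not
   intervene. *)
have [t2 t12 hB] := growth_unbounded (M%:~R + 1) hf.
have aF n : ((Num.trunc t2).+1 <= n)%N -> `|(a n)%:R - f n%:R| <= M%:~R + 1 :> R.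
  move=> n2; have t2n : t2 <= n%:R.
    by rewrite (le_trans (ltW (truncnS_gt _)))// ler_nat.
  have fn := hB _ t2n; rewrite /= in fn.
  have := floor_le (f n%:R); have := floorD1_gt (f n%:R); rewrite intrD => fl1 fl2.
  have := hM n; rewrite ler_norml -!(ler_int R) rmorphN /= => /andP[h1 h2].
  have eR : (e n)%:~R = (Num.floor (f n%:R))%:~R + (h n)%:~R :> R by rewrite intrD.
  have e0 : 0 <= e n by rewrite -(ler_int R) eR /=; lra.
  rewrite /a e0 (le_trans t01 (le_trans t12 t2n)) /=.
  have -> : `|e n|%N%:R = (e n)%:~R :> R by rewrite natr_absz ger0_norm.
  by rewrite ler_norml eR; apply/andP; split; lra.
have a_null := unif_null_growth dotE C1 Tpow noeig x hf aF.
apply/cvgrPdist_le => eps; case: eps => er ei; rewrite ltcE /= => /andP[/eqP -> er0].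
(* The factor [2] pays for summing over [n < N.+1], since [N + 1 <= 2 * N]; the factor [d] pays for
   dividing by the cardinality. *)
have ed : 0 < er * d / 2 by rewrite !(mulr_gt0, divr_gt0).
have [N2 hN2] := a_null _ ed.
exists (maxn (maxn N1 N2) 1) => // N /=; rewrite !geq_max => /andP[/andP[N1N N2N] N0].
(* The indicator of [A] serves as coefficients; it is cut at [0] because the averages start at index
   [1]. *)
pose co n : R[i] := if (0 < n)%N && (n \in A) then 1 else 0.
have co1 n : rnorm (co n) <= 1 by rewrite /co; case: ifP; rewrite ?rnorm0 ?rnorm1.
have -> : \sum_(1 <= n < N.+1 | n \in A) op_pow T t0 f h n x =
    \sum_(n < N.+1) co n *: iter (a n) T x.
  rewrite -(big_mkord xpredT (fun n => co n *: iter (a n) T x)) big_ltn//.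
  rewrite {1}/co /= scale0r add0r big_mkcond /=; apply: eq_big_nat => n /andP[n0 _].
  by rewrite /co n0 op_powE /=; case: ifP; rewrite ?scale1r ?scale0r.
have N0R : 1 <= N%:R :> R by rewrite ler1n.
have cardN := hN1 _ N1N.
have card0 : 0 < (card_upto A N)%:R :> R by apply: lt_le_trans cardN; rewrite mulr_gt0//; lra.
rewrite sub0r normrN rnormE lecE /= eqxx /= rnormZ.
have -> : rnorm ((card_upto A N)%:R^-1 : R[i]) = (card_upto A N)%:R^-1.
  by rewrite -(rmorph_nat (real_complex R)) -fmorphV rnorm_real ger0_norm ?invr_ge0.
rewrite ler_pdivrMl// (le_trans (hN2 N.+1 (leqW N2N) co co1))//.
apply: (@le_trans _ _ (d * N%:R * er)); last by rewrite ler_wpM2r// ltW.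
have erd : 0 <= er * d by rewrite mulr_ge0// ltW.
have := ler_wpM2l erd N0R; rewrite -[N.+1%:R]natr1; lra.
Qed.
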